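(* Let $q\in(-1,1)$. i) Let $|r|<1$ and suppose $Z$ has density $f_R(z|r,q)$, $z\in S(q)$. Then for $n\ge0$ $$EH_{2n}(Z|q)=\frac{r^n[2n]_q!}{[n]_q!(rq)_n}.$$ In particular $EZ=0$ and $\operatorname{var}(Z)=EZ^2=\frac{1+r}{1-rq}$. ii) Let $\rho_{12},\rho_{13},\rho_{23}\in(-1,1)$, $r=\rho_{12}\rho_{13}\rho_{23}$, and let $(Y,Z)$ have the density $f_{YZ}(y,z|\rho_{12},\rho_{13},\rho_{23},q)$ defined in the context. Then for $m,n\ge0$ $$EH_m(Y|q)H_n(Z|q)=(1-r)\sum_{s}\frac{1}{[\frac{s-m}{2}]_q!\,[\frac{s-n}{2}]_q!}\sum_{k=\frac s2-\min(\frac n2,\frac m2)}^{\frac s2+\min(\frac n2,\frac m2)}\rho_{23}^k(\rho_{12}\rho_{13})^{s-k}{m\brack k-\frac{s-m}{2}}_q{n\brack k-\frac{s-n}{2}}_q[k]_q!\,[s-k]_q!,$$ where the outer sum is over all integers $s\ge\max(n,m)$ such that $s-m$ and $s-n$ are both even (the sum being $0$ if there are none). In particular $$\operatorname{cov}(Y,Z)=\frac{\rho_{23}+\rho_{12}\rho_{13}}{1-rq}.$$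
   Context: For $|q|<1$ let $S(q)=[-2/\sqrt{1-q},2/\sqrt{1-q}]$, $[0]_q=0$, $[n]_q=1+q+\dots+q^{n-1}$ for $n\ge1$, $[0]_q!=1$, $[n]_q!=\prod_{i=1}^n[i]_q$, ${n\brack k}_q=\frac{[n]_q!}{[k]_q![n-k]_q!}$ for $0\le k\le n$ and $0$ otherwise; $(a)_0=1$, $(a)_j=\prod_{k=1}^j(1-aq^{k-1})$, $(a)_\infty=\prod_{k=0}^\infty(1-aq^k)$. Define $$l_q(x|a)=(1+a)^2-(1-q)ax^2,\qquad \omega_q(x,y|\rho)=(1-\rho^2)^2-(1-q)xy\rho(1+\rho^2)+(1-q)\rho^2(x^2+y^2),$$ $$f_N(x|q)=\frac{(q)_\infty\sqrt{1-q}\sqrt{4-(1-q)x^2}}{2\pi}\prod_{i=1}^\infty l_q(x|q^i),\qquad f_R(x|\beta,q)=f_N(x|q)\frac{(\beta^2)_\infty}{(\beta)_\infty(\beta q)_\infty\prod_{i=0}^\infty l_q(x|\beta q^i)},$$ and, for $y,z\in S(q)$ and $r=\rho_{12}\rho_{13}\rho_{23}$, $$f_{YZ}(y,z|\rho_{12},\rho_{13},\rho_{23},q)=(1-r)f_N(y|q)f_N(z|q)\frac{(\rho_{23}^2)_\infty(\rho_{12}^2\rho_{13}^2)_\infty}{\prod_{i=0}^\infty\omega_q(y,z|\rho_{23}q^i)\,\omega_q(y,z|\rho_{12}\rho_{13}q^i)},$$ which is a probability density on $S(q)^2$ whose one-dimensional marginals are both $f_R(\cdot|r,q)$. The $q$-Hermite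 polynomials are given by $H_{-1}(x|q)=0$, $H_0(x|q)=1$, $H_{n+1}(x|q)=xH_n(x|q)-[n]_qH_{n-1}(x|q)$. *)

(* Defs.v *)
From HB Require Import structures.
From mathcomp Require Export all_boot all_order all_algebra.
From mathcomp Require Export all_classical all_reals all_analysis.

Set Implicit Arguments.
Unset Strict Implicit.
Unset Printing Implicit Defensive.

Import Order.TTheory GRing.Theory Num.Theory.
Import numFieldNormedType.Exports.

Local Open Scope classical_set_scope.
Local Open Scope ring_scope.

Section QAnalogues.
Context {R : realType}.
Implicit Types (q a b x y z : R) (n k s : nat).

Definition qnat q n : R := \sum_(i < n) q ^+ i.

Definition qfact q n : R := \prod_(1 <= i < n.+1) qnat q i.

Definition qbinom q n k : R :=
  if (k <= n)%N then qfact q n / (qfact q k * qfact q (n - k)) else 0.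

(* (a)_n; the base q is left implicit in the usual notation *)
Definition qpoch q a n : R := \prod_(0 <= k < n) (1 - a * q ^+ k).

(* Here and below, infinite products are limits of the partial products; they
   converge for `|q| < 1. *)
Definition qpoch_oo q a : R := limn (qpoch q a).

Fixpoint qhermite q n : {poly R} :=
  if n is n'.+1 then
    'X * qhermite q n' -
    qnat q n' *: (if n' is n''.+1 then qhermite q n'' else 0)
  else 1.

Definition supp q : set R :=
  `[- (2 / Num.sqrt (1 - q)), 2 / Num.sqrt (1 - q)]%classic.

Definition lq q x a : R := (1 + a) ^+ 2 - (1 - q) * a * x ^+ 2.

Definition omegaq q x y (rho : R) : R :=
  (1 - rho ^+ 2) ^+ 2 - (1 - q) * x * y * rho * (1 + rho ^+ 2)
  + (1 - q) * rho ^+ 2 * (x ^+ 2 + y ^+ 2).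

Definition fN q x : R :=
  qpoch_oo q q * Num.sqrt (1 - q) * Num.sqrt (4 - (1 - q) * x ^+ 2) / (2 * pi)
  * limn (fun N : nat => \prod_(1 <= i < N) lq q x (q ^+ i)).

Definition fR q (beta : R) x : R :=
  fN q x * (qpoch_oo q (beta ^+ 2) /
    (qpoch_oo q beta * qpoch_oo q (beta * q) *
     limn (fun N : nat => \prod_(0 <= i < N) lq q x (beta * q ^+ i)))).

Definition fYZ q (rho12 rho13 rho23 : R) y z : R :=
  (1 - rho12 * rho13 * rho23) * fN q y * fN q z *
  (qpoch_oo q (rho23 ^+ 2) * qpoch_oo q (rho12 ^+ 2 * rho13 ^+ 2) /
   limn (fun N : nat => \prod_(0 <= i < N)
     (omegaq q y z (rho23 * q ^+ i) *
      omegaq q y z (rho12 * rho13 * q ^+ i)))).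

(* The summand of index s in the formula for E[H_m(Y) H_n(Z)], with
   a = rho23 and b = rho12 * rho13. It is only used when s >= max(m, n) and
   s - m, s - n are even; then all the halvings and subtractions in nat below
   are exact, and the bounds on k are s/2 -+ min(m/2, n/2). *)
Definition mixed_term q a b (m n s : nat) : R :=
  (qfact q ((s - m)./2) * qfact q ((s - n)./2))^-1 *
  \sum_((s - minn m n)./2 <= k < ((s + minn m n)./2).+1)
    a ^+ k * b ^+ (s - k) *
    qbinom q m (k - (s - m)./2) * qbinom q n (k - (s - n)./2) *
    qfact q k * qfact q (s - k).

Definition mixed_sum q a b (m n N : nat) : R :=
  \sum_(maxn m n <= s < N | ~~ odd (s - m) && ~~ odd (s - n))
    mixed_term q a b m n s.

End QAnalogues.

(* X has density f on D (and 0 outside D) with respect to mu. *)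
Definition has_density {d} {T : measurableType d} {R : realType}
    (P : probability T R) {d'} {U : measurableType d'}
    (mu : {measure set U -> \bar R}) (D : set U) (f : U -> R) (X : T -> U) :=
  forall A : set U, measurable A ->
    P (X @^-1` A) = (\int[mu]_(u in A `&` D) (f u)%:E)%E.

(* Main.v *)
From HB Require Import structures.
Require Import Defs.
From mathcomp Require Import measurable_realfun.
From mathcomp Require Import ring lra zify.

Set Implicit Arguments.
Unset Strict Implicit.
Unset Printing Implicit Defensive.

Import Order.TTheory GRing.Theory Num.Theory.
Import numFieldNormedType.Exports.

Local Open Scope classical_set_scope.
Local Open Scope ring_scope.

(** Write L for integration against the density [fN] on its support. Both parts
    come from integrating a series term by term against L, and rest on three
    facts.

    The Poisson-Mehler formula. For |rho| < 1 the kernel [mehler q rho x y], the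
    sum of rho^k H_k(x) H_k(y) / [k]_q! over k, is (rho^2)_oo divided by the
    product of the omega_q(x, y | rho q^i). Indeed the three-term recurrence
    amounts to the q-difference equation [mehler_mul], whose iteration pushes
    rho to 0, where the kernel is 1 ([mehler_cvg]). On the diagonal omega_q is a
    multiple of l_q, so the formula also governs the products in [fN] and [fR].
    It turns the densities into (1 - r) f_N(x) times the kernel at (x, x)
    ([fRE]), and (1 - r) f_N(y) f_N(z) times two kernels ([fYZE]). Convergence
    is geometric, since q-Hermite polynomials grow subexponentially on the
    support once scaled ([qhermite_le_majorant], [majorant_growth]).

    Orthogonality: L H_n = 0 for n > 0 ([fN_functional]). Truncating the product
    in [fN] leaves a polynomial times the semicircle, which up to a constant is
    f_R(.|b) with b a power of q. For these weights the formula of part i) can be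
    proved by induction on the number of factors: multiplying by l_q(.|b)
    replaces b by b q, a rational identity ([rogers_moments_mul_lq]). The
    induction starts at the semicircle itself, where integration by parts
    controls Chebyshev polynomials ([semicircle_FTC],
    [semicircle_qhermite_cheb]). Without truncation b tends to 0, and with it
    the moments of positive order.

    Triple products: for any functional with this orthogonality,
    L (H_m H_k H_j) is an explicit multiple of L 1 ([functional_qhermite3]); the
    recurrence in m against the one in k determines it.

    For part i) this gives (1 - r) times the sum of r^k L (H_2n H_k^2) / [k]_q!,
    a q-binomial series ([qbin_series_cvg]). For part ii), the product of the two
    kernels is summed by total degree s; the integrals factor by Fubini, and the
    terms of degree s add up to the summand of index s of the claim
    ([mixed_triplesE]). The total mass L 1 is never computed: that the given laws
    have mass 1 forces L 1 = 1 in part i) and (L 1)^2 = 1 in part ii), which is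
    all that enters. *)

(** * q-numbers and the three-term recurrence *)

Section QNumbers.
Context {R : realType} (q : R) (hq : -1 < q < 1).
Implicit Types (n k : nat).

Lemma qnatE n : (1 - q) * qnat q n = 1 - q ^+ n.
Proof. by rewrite /qnat -opprB mulNr -subrX1 opprB. Qed.

Lemma subr1q_neq0 : 1 - q != 0.
Proof. by case/andP: hq => _ q1; rewrite subr_eq0 gt_eqF. Qed.

Lemma qnat_def n : qnat q n = (1 - q ^+ n) / (1 - q).
Proof. by rewrite -qnatE mulrC mulKf// subr1q_neq0. Qed.

Lemma qnat0 : qnat q 0 = 0.
Proof. by rewrite /qnat big_ord0. Qed.

Lemma qnat1 : qnat q 1 = 1.
Proof. by rewrite /qnat big_ord1 expr0. Qed.

Lemma normq_lt1 : `|q| < 1.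
Proof. by rewrite ltr_norml. Qed.

Lemma normqX_le n : `|q ^+ n| <= 1.
Proof. by rewrite normrX exprn_ile1// ltW// normq_lt1. Qed.

Lemma subr1_Xq_gt0 a n : `|a| < 1 -> 0 < 1 - a * q ^+ n.
Proof.
move=> a1; rewrite subr_gt0 (le_lt_trans (ler_norm _))// normrM.
by rewrite (le_lt_trans _ a1)// ler_piMr// normqX_le.
Qed.

Lemma qnat_gt0 n : 0 < qnat q n.+1.
Proof.
case/andP: hq => _ q1; rewrite qnat_def exprS divr_gt0 ?subr_gt0//.
by rewrite -subr_gt0 subr1_Xq_gt0// normq_lt1.
Qed.

Lemma qnat_neq0 n : qnat q n.+1 != 0.
Proof. by rewrite gt_eqF// qnat_gt0. Qed.

Lemma qfact0 : qfact q 0 = 1.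
Proof. by rewrite /qfact big_geq. Qed.

Lemma qfactS n : qfact q n.+1 = qfact q n * qnat q n.+1.
Proof. by rewrite /qfact big_nat_recr. Qed.

Lemma qfact_gt0 n : 0 < qfact q n.
Proof.
elim: n => [|n IH]; first by rewrite qfact0.
by rewrite qfactS mulr_gt0// qnat_gt0.
Qed.

Lemma qfact_neq0 n : qfact q n != 0.
Proof. by rewrite gt_eqF// qfact_gt0. Qed.

Lemma qpochS a n : qpoch q a n.+1 = qpoch q a n * (1 - a * q ^+ n).
Proof. by rewrite /qpoch big_nat_recr. Qed.

Lemma qpoch0 a : qpoch q a 0 = 1.
Proof. by rewrite /qpoch big_geq. Qed.

Lemma qpoch_recl a n : qpoch q a n.+1 = (1 - a) * qpoch q (a * q) n.
Proof.
rewrite /qpoch big_nat_recl// expr0 mulr1; congr (_ * _).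
by apply: eq_bigr => i _; rewrite exprS mulrA.
Qed.

Lemma qpoch_gt0 a n : `|a| < 1 -> 0 < qpoch q a n.
Proof. by move=> a1; rewrite /qpoch; apply: prodr_gt0 => i _; exact: subr1_Xq_gt0. Qed.

Lemma qhermite0 : qhermite q 0 = 1. Proof. by []. Qed.

Lemma qhermite1 : qhermite q 1 = 'X.
Proof. by rewrite /= mulr1 scaler0 subr0. Qed.

Lemma qhermiteSS n :
  qhermite q n.+2 = 'X * qhermite q n.+1 - qnat q n.+1 *: qhermite q n.
Proof. by []. Qed.

(** The recurrence without exception at [n = 0]: there [n.-1] is [0], and the
    last term vanishes because its factor [0]_q does. *)
Lemma mulX_qhermite n :
  'X * qhermite q n = qhermite q n.+1 + qnat q n *: qhermite q n.-1.
Proof.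
case: n => [|n]; first by rewrite qhermite1 qnat0 scale0r addr0 qhermite0 mulr1.
by rewrite qhermiteSS subrK.
Qed.

End QNumbers.

Arguments qhermite : simpl never.

(** * Integrals of triple products of q-Hermite polynomials *)

Section Triple.
Context {R : realType} (q : R).
Implicit Types (m n k j : nat).

Definition triangle m k j :=
  [&& ~~ odd (m + k + j), j <= m + k, k <= m + j & m <= k + j]%N.

(** The value of [L (H m * H k * H j) / L 1] for any linear functional [L] that
    kills [H n] for all [n > 0]; see [functional_qhermite3]. *)
Definition triple m k j : R :=
  if triangle m k j then
    qfact q m * qfact q k * qfact q j /
    (qfact q (m + k - j)./2 * qfact q (m + j - k)./2 * qfact q (k + j - m)./2)
  else 0.

Lemma triple0 m k j : ~~ triangle m k j -> triple m k j = 0.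
Proof. by rewrite /triple => /negbTE ->. Qed.

(** Every triangular triple arises in this way; the parameters avoid the
    halvings and truncated subtractions of the definition. *)
Lemma tripleE a b c : triple (a + b) (a + c) (b + c) =
  qfact q (a + b) * qfact q (a + c) * qfact q (b + c) /
  (qfact q a * qfact q b * qfact q c).
Proof.
rewrite /triple ifT; last by rewrite /triangle; apply/and4P; split; lia.
have -> : ((a + b + (a + c) - (b + c))./2 = a)%N by lia.
have -> : ((a + b + (b + c) - (a + c))./2 = b)%N by lia.
have -> : ((a + c + (b + c) - (a + b))./2 = c)%N by lia.
by [].
Qed.

Lemma triangleP m k j : triangle m k j ->
  exists a b c, [/\ m = a + b, k = a + c & j = b + c]%N.
Proof.
case/and4P=> o h1 h2 h3.
exists (m + k - j)./2, (m + j - k)./2, (k + j - m)./2.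
by split; lia.
Qed.

Ltac not_triangle := by rewrite /triangle; apply/negP => /and4P[]; lia.

Lemma qnat_triple0_r m k j : ((0 < k)%N -> ~~ triangle m k.-1 j) ->
  qnat q k * triple m k.-1 j = 0.
Proof.
case: k => [|k] h; first by rewrite qnat0 mul0r.
by rewrite triple0 ?mulr0 ?h.
Qed.

Lemma qnat_triple0_l m k j : ((0 < m)%N -> ~~ triangle m.-1 k j) ->
  qnat q m * triple m.-1 k j = 0.
Proof.
case: m => [|m] h; first by rewrite qnat0 mul0r.
by rewrite triple0 ?mulr0 ?h.
Qed.

Hypothesis hq : -1 < q < 1.

(** With [m.+1 = a + b], [k = a + c], [j = b + c] and after dividing by the shared
    factorials, this is the identity
    [a + b][c + 1] = [a + c + 1][b] + [a][c + 1] - [a][b] between q-numbers. The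
    degenerate triples are those where a parameter vanishes, or where [m.+1]
    exceeds [k + j] by 2 and two equal terms cancel. *)
Lemma triple_rec m k j : triple m.+1 k j =
  triple m k.+1 j + qnat q k * triple m k.-1 j - qnat q m * triple m.-1 k j.
Proof.
have q1 := subr1q_neq0 hq.
have f0 := qfact_neq0 hq.
have n0 := qnat_neq0 hq.
have [/triangleP[a [b [c [E -> ->]]]]|T] := boolP (triangle m.+1 k j).
  case: a b E => [|a] [|b] // E.
  - have -> : m = b by lia.
    rewrite (@qnat_triple0_r b); last by move=> ?; not_triangle.
    rewrite (@qnat_triple0_l b); last by move=> ?; not_triangle.
    have -> : triple b (0 + c).+1 (b.+1 + c) = triple (0 + b) (0 + c.+1) (b + c.+1).
      by congr triple; lia.
    have -> : triple b.+1 (0 + c) (b.+1 + c) = triple (0 + b.+1) (0 + c) (b.+1 + c).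
      by congr triple; lia.
    rewrite !tripleE !(add0n, addnS, addSn) !qfactS.
    by field; rewrite !f0 ?n0.
  - have -> : m = a by lia.
    rewrite (@triple0 a); last not_triangle.
    rewrite (@qnat_triple0_l a); last by move=> ?; not_triangle.
    have -> : triple a (a.+1 + c).-1 (0 + c) = triple (a + 0) (a + c) (0 + c).
      by congr triple; lia.
    have -> : triple a.+1 (a.+1 + c) (0 + c) = triple (a.+1 + 0) (a.+1 + c) (0 + c).
      by congr triple; lia.
    rewrite !tripleE !(add0n, addn0, addnS, addSn) !qfactS.
    by field; rewrite !f0 ?n0.
  - have -> : m = (a + b).+1 by lia.
    have -> : (a + b).+2 = (a.+1 + b.+1)%N by lia.
    rewrite tripleE.
    have -> : triple (a + b).+1 (a.+1 + c).+1 (b.+1 + c) =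
              triple (a.+1 + b) (a.+1 + c.+1) (b + c.+1).
      by congr triple; lia.
    have -> : triple (a + b).+1 (a.+1 + c).-1 (b.+1 + c) =
              triple (a + b.+1) (a + c) (b.+1 + c).
      by congr triple; lia.
    have -> : triple (a + b).+1.-1 (a.+1 + c) (b.+1 + c) =
              triple (a + b) (a + c.+1) (b + c.+1).
      by congr triple; lia.
    rewrite !tripleE !(addnS, addSn) !qfactS.
    have P n : 1 - q * q ^+ n != 0.
      by rewrite gt_eqF// subr1_Xq_gt0// normq_lt1.
    have PA := P a. have PB := P b. have PC := P c.
    rewrite !(qnat_def hq) !(exprS, exprD).
    by field; rewrite !f0 ?PA ?PB ?PC ?q1.
rewrite (triple0 T).
have [odd1|odd1] := boolP (odd (m.+1 + k + j)).
  rewrite triple0; last not_triangle.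
  rewrite qnat_triple0_r; last by move=> ?; not_triangle.
  by rewrite qnat_triple0_l ?addr0 ?subr0//; move=> ?; not_triangle.
(* The one nontriangular case in which the right-hand side has nonzero terms. *)
have [E|E] := eqVneq (k + j).+1 m.
  have -> : qnat q k * triple m k.-1 j = 0 by apply: qnat_triple0_r => ?; not_triangle.
  have -> : triple m k.+1 j = triple (k.+1 + j) (k.+1 + 0) (j + 0).
    by congr triple; lia.
  have -> : triple m.-1 k j = triple (k + j) (k + 0) (j + 0) by congr triple; lia.
  have -> : qnat q m = qnat q (k + j).+1 by rewrite E.
  rewrite !tripleE !(addn0, addSn) !qfactS.
  by field; rewrite !f0 ?n0.
rewrite triple0; last by move: T odd1 E; rewrite /triangle; lia.
rewrite qnat_triple0_r; last by move: T odd1 E; rewrite /triangle; lia.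
by rewrite qnat_triple0_l ?addr0 ?subr0//; move: T odd1 E; rewrite /triangle; lia.
Qed.

End Triple.

Section Functionals.
Context {R : realType} (q : R).
Implicit Types (m n k j : nat) (p : {poly R}).
Local Notation H := (qhermite q).

Lemma triple_rot m k j : triple q m k j = triple q k j m.
Proof.
rewrite /triple; have -> : triangle m k j = triangle k j m.
  by rewrite /triangle; apply/idP/idP => /and4P[? ? ? ?]; apply/and4P; split; lia.
case: ifP => // _.
have -> : (m + k - j = k + m - j)%N by lia.
have -> : (m + j - k = j + m - k)%N by lia.
by congr (_ / _); [rewrite mulrAC -mulrA mulrC mulrAC -mulrA mulrC; ring|ring].
Qed.

Lemma triple00 n : triple q 0 n 0 = (n == 0%N)%:R.
Proof.
case: n => [|n]; last by rewrite triple0// /triangle; lia.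
have := tripleE q 0 0 0; rewrite !addn0 qfact0 => ->.
by rewrite !mulr1 divr1.
Qed.

Section Hermite_functional.
Hypothesis hq : -1 < q < 1.
Variables (Lam : {scalar {poly R}}).
Hypothesis Lam_qhermite : forall n, (0 < n)%N -> Lam (H n) = 0.

(** Computing [Lam ('X * f m k)] by the three-term recurrence in [m] and by the
    one in [k] gives a recurrence that lowers [m]; it determines the array from
    its row [m = 0]. *)
Lemma functional_array (f : nat -> nat -> {poly R}) (g : nat -> nat -> R) :
    (forall m k, 'X * f m k = f m.+1 k + qnat q m *: f m.-1 k) ->
    (forall m k, 'X * f m k = f m k.+1 + qnat q k *: f m k.-1) ->
    (forall m k, g m.+1 k =
      g m k.+1 + qnat q k * g m k.-1 - qnat q m * g m.-1 k) ->
    (forall k, Lam (f 0%N k) = g 0%N k) ->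
  forall m k, Lam (f m k) = g m k.
Proof.
move=> f1 f2 hg h0.
have scal (a : R) p : Lam (a *: p) = a * Lam p by rewrite linearZ.
elim/ltn_ind=> -[|m] IH k; first exact: h0.
have -> : f m.+1 k = f m k.+1 + qnat q k *: f m k.-1 - qnat q m *: f m.-1 k.
  by rewrite -f2 f1 addrK.
by rewrite raddfB raddfD /= !scal hg !IH//; case: m {IH}.
Qed.

Lemma functional_qhermite2 k j : Lam (H k * H j) = triple q k j 0 * Lam 1.
Proof.
apply: (functional_array (f := fun k j => H k * H j)
                         (g := fun k j => triple q k j 0 * Lam 1)) => {k j}.
- by move=> k j; rewrite mulrA mulX_qhermite mulrDl scalerAl.
- by move=> k j; rewrite mulrCA mulX_qhermite mulrDr scalerAr.
- by move=> k j; rewrite triple_rec//; ring.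
move=> k; rewrite mul1r triple00; case: k => [|k]; first by rewrite mul1r.
by rewrite Lam_qhermite// mul0r.
Qed.

(** The linearization of products of q-Hermite polynomials, in integrated form. *)
Lemma functional_qhermite3 m k j :
  Lam (H m * H k * H j) = triple q m k j * Lam 1.
Proof.
apply: (functional_array (f := fun m k => H m * H k * H j)
                         (g := fun m k => triple q m k j * Lam 1)) => {m k}.
- by move=> m k; rewrite !mulrA mulX_qhermite !mulrDl !scalerAl.
- move=> m k; rewrite mulrA (mulrCA 'X) mulX_qhermite mulrDr mulrDl.
  by rewrite -scalerAr -scalerAl.
- by move=> m k; rewrite triple_rec//; ring.
by move=> k; rewrite mul1r functional_qhermite2 [in RHS]triple_rot.
Qed.

End Hermite_functional.

End Functionals.

(** * The semicircle law and its Rogers moments *)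

Section Semicircle_functional.
Context {R : realType} (q : R).
Implicit Types (m n k j : nat) (p : {poly R}).
Local Notation H := (qhermite q).

(** Chebyshev polynomials of the second kind in t = (1 - q)^(1/2) x / 2, times
    (1 - q)^(n/2): with this factor no square root enters the recurrence. *)
Fixpoint cheb n : {poly R} :=
  if n is n'.+1 then
    (1 - q) *: ('X * cheb n' - (if n' is n''.+1 then cheb n'' else 0))
  else 1.

Lemma chebSS n :
  cheb n.+2 = (1 - q)%:P * ('X * cheb n.+1 - cheb n).
Proof. by rewrite mul_polyC. Qed.

Lemma cheb1 : cheb 1 = (1 - q)%:P * 'X.
Proof. by rewrite /= subr0 mulr1 mul_polyC. Qed.

Let four : 4%:P = 4 :> {poly R}.
Proof. by rewrite -polyC_natr. Qed.

Let three : 3%:P = 3 :> {poly R}.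
Proof. by rewrite -polyC_natr. Qed.

(** The relation (1 - t^2) U_n' = (n + 2) t U_n - (n + 1) U_(n+1), rescaled. *)
Lemma cheb_deriv n :
  (4%:P - (1 - q)%:P * 'X^2) * (cheb n)^`() =
  (n + 2)%:R * (1 - q)%:P * 'X * cheb n - (2 * n.+1)%:R * cheb n.+1.
Proof.
pose rel n := (4%:P - (1 - q)%:P * 'X^2) * (cheb n)^`() =
  (n + 2)%:R * (1 - q)%:P * 'X * cheb n - (2 * n.+1)%:R * cheb n.+1.
suff : rel n /\ rel n.+1 by case.
rewrite /rel {rel}; elim: n => [|n [IH0 IH1]]; split => //.
- rewrite cheb1 derivC.
  have id (A : comNzRingType) (G K X : A) :
    G * 0 = (0 + 2)%:R * K * X * 1 - (2 * 1)%:R * (K * X) by ring.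
  exact: id.
- rewrite chebSS cheb1 derivM derivC derivX four.
  have id (A : comNzRingType) (K X : A) :
    (4 - K * X ^+ 2) * (0 * X + K * 1) =
    (1 + 2)%:R * K * X * (K * X) - (2 * 2)%:R * (K * (X * (K * X) - 1)) by ring.
  exact: id.
have id (A : comNzRingType) (a : nat) (G K X u0 u1 d0 d1 : A) :
  let u2 := K * (X * u1 - u0) in
  G = 4 - K * X ^+ 2 ->
  G * d0 = (a + 2)%:R * K * X * u0 - (2 * a.+1)%:R * u1 ->
  G * d1 = (a.+1 + 2)%:R * K * X * u1 - (2 * a.+2)%:R * u2 ->
  G * (0 * (X * u1 - u0) + K * (1 * u1 + X * d1 - d0)) =
  (a.+2 + 2)%:R * K * X * u2 - (2 * a.+3)%:R * (K * (X * u2 - u1)).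
  move=> u2 G4 E0 E1.
  rewrite (_ : _ * _ = K * (G * u1) + K * X * (G * d1) - K * (G * d0)); last by ring.
  by rewrite E0 E1 {}G4 /u2; ring.
rewrite !(chebSS n.+1) (chebSS n) derivM derivC derivB derivM derivX.
apply: id IH0 _; first by rewrite four.
by rewrite IH1 (chebSS n).
Qed.

Arguments cheb : simpl never.

(** The value of [sig (H n * cheb j) / sig 1] for the semicircle functional [sig]. *)
Definition semicircle_moment n j : R :=
  if (j <= n)%N && ~~ odd (n - j) then
    q ^+ (n - j)./2 * qfact q n * qnat q j.+1 /
    ((1 - q) ^+ (n - j)./2 * qfact q (n - j)./2 * qfact q ((n + j)./2).+1)
  else 0.

Lemma semicircle_momentE k j : semicircle_moment (k + k + j) j =
  q ^+ k * qfact q (k + k + j) * qnat q j.+1 /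
  ((1 - q) ^+ k * qfact q k * qfact q (k + j).+1).
Proof.
rewrite /semicircle_moment ifT; last by lia.
have -> : ((k + k + j - j)./2 = k)%N by lia.
by have -> : ((k + k + j + j)./2 = k + j)%N by lia.
Qed.

Lemma semicircle_moment0 n j : ~~ ((j <= n)%N && ~~ odd (n - j)) ->
  semicircle_moment n j = 0.
Proof. by rewrite /semicircle_moment => /negbTE ->. Qed.

Section Sigma.
Hypothesis hq : -1 < q < 1.
Variable sig : {scalar {poly R}}.
Hypothesis sig_deriv : forall p,
  sig ((4%:P - (1 - q)%:P * 'X^2) * p^`() - 3%:P * (1 - q)%:P * 'X * p) = 0.

Let scal (a : R) p : sig (a%:P * p) = a * sig p.
Proof. by rewrite mul_polyC linearZ. Qed.

(** Inserting [cheb n] into the hypothesis [sig_deriv] (integration by parts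
    against the semicircle) gives, by [cheb_deriv] and the recurrence, a multiple
    of [sig (cheb n.+1)] in terms of [sig (cheb n.-1)]. *)
Lemma semicircle_cheb n : (0 < n)%N -> sig (cheb n) = 0.
Proof.
have step m : (m + 3)%:R * sig (cheb m.+1) =
    (m%:R - 1) * (1 - q) * (if m is m'.+1 then sig (cheb m') else 0).
  have := sig_deriv (cheb m); rewrite cheb_deriv three.
  case: m => [|m].
    rewrite (_ : _ - _ = - (3%:P * cheb 1)).
      by rewrite raddfN /= scal mulr0 => /eqP; rewrite oppr_eq0 => /eqP.
    rewrite cheb1 three.
    have id (A : comNzRingType) (K X : A) :
      (0 + 2)%:R * K * X * 1 - (2 * 1)%:R * (K * X) - 3 * K * X * 1
      = - (3 * (K * X)) by ring.
    exact: id.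
  rewrite (_ : _ - _ = (m%:R * (1 - q))%:P * cheb m - (m + 4)%:R%:P * cheb m.+2).
    rewrite raddfB /= !scal => /eqP; rewrite subr_eq0 => /eqP E.
    by rewrite addSnnS -E -natr1 addrK.
  rewrite chebSS polyCM !polyC_natr.
  have id (A : comNzRingType) (K X u0 u1 : A) :
    let u2 := K * (X * u1 - u0) in
    (m.+1 + 2)%:R * K * X * u1 - (2 * m.+2)%:R * u2 - 3 * K * X * u1
    = m%:R * K * u0 - (m + 4)%:R * u2 by move=> u2; rewrite /u2; ring.
  exact: id.
elim/ltn_ind: n => -[//|n] IH _.
have := step n.
rewrite (_ : _ * (if _ is _.+1 then _ else _) = 0); last first.
  case: n IH => [|[|n]] IH; first by rewrite /= mulr0.
    by rewrite subrr !mul0r.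
  by rewrite IH ?mulr0.
by move=> /eqP; rewrite mulf_eq0 pnatr_eq0 addn3 => /eqP.
Qed.

(** The compatibility of [semicircle_moment] with multiplication by ['X], expanded
    in [H n] and in [cheb j]. *)
Lemma semicircle_moment_rec n j : (1 - q) * semicircle_moment n.+1 j =
  semicircle_moment n j.+1 + (1 - q) * (if j is j'.+1 then semicircle_moment n j' else 0)
  - (1 - q) * (qnat q n * semicircle_moment n.-1 j).
Proof.
have q1 := subr1q_neq0 hq.
have f0 := qfact_neq0 hq.
have n0 := qnat_neq0 hq.
have P n' : 1 - q * q ^+ n' != 0.
  by rewrite gt_eqF// subr1_Xq_gt0// normq_lt1.
have pred0 j' : ((0 < n)%N -> ~~ ((j' <= n.-1)%N && ~~ odd (n.-1 - j'))) ->
    qnat q n * semicircle_moment n.-1 j' = 0.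
  case: (n) => [|n'] h; first by rewrite qnat0 mul0r.
  by rewrite semicircle_moment0 ?mulr0 ?h.
have [/andP[jn odd1]|T] := boolP ((j <= n.+1)%N && ~~ odd (n.+1 - j)).
  have [k E] : exists k, (n.+1 = k + k + j)%N by exists (n.+1 - j)./2; lia.
  case: k E => [|k] E.
    rewrite pred0; last by lia.
    rewrite (@semicircle_moment0 n j.+1); last by lia.
    case: j jn odd1 E => [|j] jn odd1 E; first by lia.
    have -> : n = (0 + 0 + j)%N by lia.
    have -> : ((0 + 0 + j).+1 = 0 + 0 + j.+1)%N by lia.
    rewrite !semicircle_momentE !(addn0,add0n) !qfactS !expr0 qfact0.
    by field; rewrite ?f0 ?n0.
  have -> : semicircle_moment n.+1 j = semicircle_moment (k.+1 + k.+1 + j) j.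
    by congr semicircle_moment; lia.
  have -> : semicircle_moment n j.+1 = semicircle_moment (k + k + j.+1) j.+1.
    by congr semicircle_moment; lia.
  have -> : qnat q n * semicircle_moment n.-1 j =
      qnat q (k + k + j).+1 * semicircle_moment (k + k + j) j.
    by congr (qnat _ _ * semicircle_moment _ _); lia.
  have -> : (if j is j'.+1 then semicircle_moment n j' else 0) =
      q ^+ k.+1 * qfact q (k + k + j).+1 * qnat q j /
      ((1 - q) ^+ k.+1 * qfact q k.+1 * qfact q (k + j).+1).
    case: j {jn odd1} E => [|j] E; first by rewrite qnat0 mulr0 mul0r.
    have -> : n = (k.+1 + k.+1 + j)%N by lia.
    rewrite semicircle_momentE; congr (_ * qfact _ _ * _ / (_ * qfact _ _)); lia.
  rewrite !semicircle_momentE !(addnS, addSn) !qfactS.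
  rewrite !(qnat_def hq) !(exprS, exprD).
  have PJ := P j. have PK := P k.
  have PP := P (k + j)%N. have PQ := P (k + j).+1.
  move: PP PQ; rewrite !(exprS, exprD) => PP PQ.
  by field; rewrite !f0 ?PJ ?PK ?PP ?PQ ?q1 ?expf_neq0.
rewrite (semicircle_moment0 T) pred0; last by lia.
rewrite (@semicircle_moment0 n j.+1); last by lia.
case: j T => [|j] T; first by rewrite !mulr0 addr0 subr0.
by rewrite semicircle_moment0 ?mulr0 ?addr0 ?subr0//; lia.
Qed.

Lemma semicircle_qhermite_cheb n j : sig (H n * cheb j) = semicircle_moment n j * sig 1.
Proof.
have q1 := subr1q_neq0 hq.
have cE j' : (1 - q)%:P * ('X * cheb j') =
    cheb j'.+1 + (1 - q)%:P * (if j' is j''.+1 then cheb j'' else 0).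
  case: j' => [|j']; first by rewrite cheb1 /= mulr0 addr0 mulr1.
  by rewrite chebSS; ring.
elim/ltn_ind: n j => -[|n] IH j.
  rewrite mul1r; case: j => [|j].
    have := semicircle_momentE 0 0; rewrite !addn0 !qfactS !expr0 qfact0 qnat1 => ->.
    by rewrite !mulr1 invr1 !mul1r.
  by rewrite semicircle_cheb// semicircle_moment0 ?mul0r.
apply: (mulfI q1); rewrite -[LHS]scal.
have -> : (1 - q)%:P * (H n.+1 * cheb j) =
    H n * cheb j.+1 + (1 - q)%:P * (H n * (if j is j'.+1 then cheb j' else 0))
    - (1 - q)%:P * ((qnat q n)%:P * (H n.-1 * cheb j)).
  have -> : H n.+1 = 'X * H n - (qnat q n)%:P * H n.-1.
    by rewrite mulX_qhermite mul_polyC addrK.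
  have -> : (1 - q)%:P * (('X * H n - (qnat q n)%:P * H n.-1) * cheb j) =
    H n * ((1 - q)%:P * ('X * cheb j)) -
     (1 - q)%:P * ((qnat q n)%:P * (H n.-1 * cheb j)) by ring.
  have id (A : comNzRingType) (K h h' a u v w : A) :
    h * (u + K * v) - K * (a * (h' * w)) =
    h * u + K * (h * v) - K * (a * (h' * w)) by ring.
  by rewrite cE; exact: id.
rewrite raddfB raddfD /= !scal (IH n)// (IH n.-1); last first.
  exact: (leq_ltn_trans (leq_pred n)).
have -> : sig (H n * (if j is j'.+1 then cheb j' else 0)) =
    (if j is j'.+1 then semicircle_moment n j' else 0) * sig 1.
  by case: (j) => [|j']; rewrite ?mulr0 ?raddf0 ?mul0r ?IH.
rewrite [RHS]mulrA semicircle_moment_rec.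
by rewrite [RHS]mulrBl [X in _ = X - _]mulrDl !mulrA.
Qed.

Lemma semicircle_odd n : sig (H (2 * n).+1) = 0.
Proof.
have := semicircle_qhermite_cheb (2 * n).+1 0.
by rewrite mulr1 => ->; rewrite semicircle_moment0 ?mul0r//; lia.
Qed.

End Sigma.
End Semicircle_functional.

Section Moments.
Context {R : realType} (q : R).
Hypothesis hq : -1 < q < 1.
Local Notation H := (qhermite q).

(** The value of the integral of [H (2 * n)] against the density [fR q b]. *)
Definition rogers_moment (b : R) n : R :=
  b ^+ n * qfact q (2 * n) / (qfact q n * qpoch q (b * q) n).

Definition has_rogers_moments (Lam : {poly R} -> R) (b : R) :=
  (forall n, Lam (H (2 * n)) = rogers_moment b n * Lam 1) /\
  (forall n, Lam (H (2 * n).+1) = 0).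

Lemma qpoch_qq n : qpoch q (q * q) n = (1 - q) ^+ n * qfact q n.+1.
Proof.
elim: n => [|n IH]; first by rewrite qpoch0 qfactS qfact0 qnat1 expr0 !mulr1.
rewrite qpochS IH [in RHS]qfactS (qnat_def hq) !exprS.
by field; rewrite subr1q_neq0.
Qed.

(** The semicircle law is [fR q q]. *)
Lemma semicircle_rogers_moments (sig : {scalar {poly R}}) :
  (forall p, sig ((4%:P - (1 - q)%:P * 'X^2) * p^`()
                  - 3%:P * (1 - q)%:P * 'X * p) = 0) ->
  has_rogers_moments sig q.
Proof.
move=> hs; split => n; last exact: semicircle_odd.
have := semicircle_qhermite_cheb hq hs (2 * n) 0; rewrite mulr1 => ->.
congr (_ * _); have -> : (2 * n = n + n + 0)%N by lia.
rewrite semicircle_momentE !addn0 qnat1 mulr1 /rogers_moment mul2n addnn qpoch_qq.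
congr (_ / _).
by rewrite mulrCA mulrA.
Qed.

Lemma mulX2_qhermite k : 'X^2 * H k =
  H k.+2 + (qnat q k.+1 + qnat q k) *: H k + (qnat q k * qnat q k.-1) *: H k.-2.
Proof.
rewrite expr2 -mulrA mulX_qhermite mulrDr mulX_qhermite -scalerAr mulX_qhermite.
rewrite scalerDr scalerA scalerDl !addrA.
by case: k => [|k] //; rewrite qnat0 !scale0r.
Qed.

Lemma rogers_moment0 b : rogers_moment b 0 = 1.
Proof. by rewrite /rogers_moment muln0 expr0 qpoch0 qfact0 !mulr1 divr1. Qed.

(** Multiplying the weight by [lq q x b] turns [fR q b] into a multiple of
    [fR q (b * q)]. *)
Lemma rogers_moments_mul_lq (Lam Lam' : {scalar {poly R}}) b : `|b| < 1 ->
  (forall p, Lam' p =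
     Lam (((1 + b) ^+ 2)%:P * p - ((1 - q) * b)%:P * ('X^2 * p))) ->
  has_rogers_moments Lam b -> has_rogers_moments Lam' (b * q).
Proof.
move=> b1 LL' [Le Lo].
have scal (a : R) p : Lam (a *: p) = a * Lam p by rewrite linearZ.
have LE k : Lam' (H k) = (1 + b) ^+ 2 * Lam (H k) - (1 - q) * b *
    (Lam (H k.+2) + (qnat q k.+1 + qnat q k) * Lam (H k)
     + qnat q k * qnat q k.-1 * Lam (H k.-2)).
  by rewrite LL' !mul_polyC raddfB /= !scal mulX2_qhermite !raddfD /= !scal.
have f0 := qfact_neq0 hq.
have p0 m : 1 - b * q * q ^+ m != 0.
  rewrite gt_eqF// subr1_Xq_gt0// normrM (le_lt_trans _ b1)// ler_piMr//.
  by rewrite ltW// normq_lt1.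
have P0 m : qpoch q (b * q) m != 0.
  rewrite gt_eqF// qpoch_gt0// normrM (le_lt_trans _ b1)// ler_piMr//.
  by rewrite ltW// normq_lt1.
split => n; last first.
  rewrite LE Lo; have -> : (2 * n).+3 = (2 * n.+1).+1 by lia.
  rewrite Lo; case: n => [|n].
    by rewrite qnat0 !(mulr0, mul0r, addr0, subr0).
  have -> : (2 * n.+1).+1.-2 = (2 * n).+1 by lia.
  by rewrite Lo !(mulr0, addr0, subr0).
case: n => [|n]; first by rewrite rogers_moment0 mul1r.
have L1 : Lam' 1 = ((1 + b) ^+ 2 - (1 - q) * b * (rogers_moment b 1 + 1)) * Lam 1.
  rewrite -[1]/(H 0) LE qnat0 qnat1 (Le 1%N) -[H 0]/1.
  by ring.
rewrite LE L1.
have -> : (2 * n.+1).-2 = (2 * n)%N by lia.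
have -> : (2 * n.+1).+2 = (2 * n.+2)%N by lia.
rewrite !Le /rogers_moment.
have -> : qpoch q (b * q * q) n.+1 = qpoch q (b * q) n * (1 - b * q * q ^+ n)
   * (1 - b * q * q ^+ n.+1) / (1 - b * q).
  have := p0 0%N; rewrite mulr1 => p00.
  by rewrite -!qpochS [in RHS]qpoch_recl [RHS]mulrAC mulfV// mul1r.
rewrite !qpochS qpoch0 expr0.
have -> : (2 * n.+2 = (n + n).+4)%N by lia.
have -> : (2 * n.+1 = (n + n).+2)%N by lia.
have -> : (2 * n = (n + n))%N by lia.
rewrite muln1 [(n + n).+2.-1]/= !qfactS qfact0.
have q1 := subr1q_neq0 hq.
have := p0 0%N; have := p0 n; have := p0 n.+1.
rewrite !(qnat_def hq) !(exprS, exprD) expr0 exprMn.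
have Pn m : 1 - q * q ^+ m != 0.
  by rewrite gt_eqF// subr1_Xq_gt0// normq_lt1.
have := Pn n.+1; rewrite exprS.
move: (P0 n) (f0 n) (f0 (n + n)%N) (Pn n).
move: (qpoch _ _ _) (qfact q n) (qfact q (n + n)) (q ^+ n) (b ^+ n).
move=> P F F2 A B hP hF hF2 hA hA' h1 h2; rewrite !mulr1 => h3.
by field; rewrite hP hF hA hA' h1 h2 h3 q1.
Qed.

End Moments.

(** * Geometric bounds and q-shifted factorials *)

Section Growth.
Context {R : realType}.
Implicit Types (x : nat -> R) (n k : nat).

(** The constant takes care of the finitely many indices at which the ratio bound
    fails. *)
Lemma geometric_growth x (w : R) : 0 < w ->
  (\forall n \near \oo, x n.+1 <= w * x n) ->
  exists2 C, 0 <= C & forall n, x n <= C * w ^+ n.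
Proof.
move=> w0 [N _ hN].
exists (\sum_(i < N.+1) `|x i| / w ^+ i).
  by apply: sumr_ge0 => i _; rewrite divr_ge0// exprn_ge0// ltW.
have small n : (n <= N)%N -> x n <= (\sum_(i < N.+1) `|x i| / w ^+ i) * w ^+ n.
  move=> nN; rewrite -ler_pdivrMr ?exprn_gt0//.
  rewrite (bigD1 (Ordinal (nN : (n < N.+1)%N)))//=.
  rewrite (le_trans (y := `|x n| / w ^+ n))//.
    by rewrite ler_pM2r ?invr_gt0 ?exprn_gt0// ler_norm.
  rewrite lerDl; apply: sumr_ge0 => i _.
  by rewrite divr_ge0// exprn_ge0// ltW.
elim=> [|n IH]; first exact: small.
have [nN|nN] := leqP n.+1 N; first exact: small.
rewrite (le_trans (hN n _))// exprS mulrCA ler_pM2l//.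
Qed.

Lemma geometric_dominated_cvg (c : nat -> R) (C w : R) : 0 <= w < 1 ->
  (forall k, `|c k| <= C * w ^+ k) -> cvgn (series c).
Proof.
move=> /andP[w0 w1] h; apply: normed_cvg.
apply: (@series_le_cvg _ (fun k => `|c k|) (geometric C w)) => //.
- move=> n; rewrite /geometric /= mulr_ge0 ?exprn_ge0//.
  by have := h 0%N; rewrite expr0 mulr1; apply: le_trans.
- by apply: is_cvg_geometric_series; rewrite ger0_norm.
Qed.

Lemma geometric_sum_le (w : R) n : 0 <= w < 1 ->
  \sum_(0 <= k < n) w ^+ k <= (1 - w)^-1.
Proof.
move=> /andP[w0 w1]; have w1' : 0 < 1 - w by rewrite subr_gt0.
rewrite -[leRHS]mul1r ler_pdivlMr// mulrC big_mkord -opprB mulNr -subrX1 opprB.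
by rewrite lerBlDr lerDl exprn_ge0.
Qed.

Lemma cvgn_unique (u : nat -> R) (l l' : R) :
  u n @[n --> \oo] --> l -> u n @[n --> \oo] --> l' -> l = l'.
Proof.
by move=> h h'; apply: etrans (cvg_lim _ h') => //; symmetry; exact: cvg_lim h.
Qed.

Lemma cvg_double (u : nat -> R) (l : R) :
  u n @[n --> \oo] --> l -> u (2 * n)%N @[n --> \oo] --> l.
Proof.
have c2 : (fun n => 2 * n)%N @ \oo --> \oo.
  by apply/cvgnyPge => A; exists A => // n /= An; lia.
by move=> cu; exact: (cvg_comp _ _ c2 cu).
Qed.

Lemma cvg_geometric_bound (u : nat -> R) (w C : R) : `|w| < 1 ->
  (forall n, `|u n| <= `|w| ^+ n * C) -> u n @[n --> \oo] --> 0.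
Proof.
move=> w1 h; apply/norm_cvg0P.
apply: (@squeeze_cvgr _ _ _ _ (cst 0) (fun n => `|w| ^+ n * C)).
- by apply: nearW => n; rewrite normr_ge0 h.
- exact: cvg_cst.
- rewrite -[X in _ --> X](mul0r C); apply: cvgMl; apply: cvg_expr.
  by rewrite normr_id.
Qed.

(** A power series at [q ^+ N] differs from its constant term by at most
    [`|q| ^+ N] times a fixed geometric sum. *)
Lemma pseries_cvg0 (c : nat -> R) (C w q : R) : `|q| < 1 -> 0 <= w < 1 ->
  (forall k, `|c k| <= C * w ^+ k) ->
  limn (series (fun k => c k * (q ^+ N) ^+ k)) @[N --> \oo] --> c 0%N.
Proof.
move=> q1 w01 h; have [w0 w1] := andP w01.
have C0 : 0 <= C by have := h 0%N; rewrite expr0 mulr1; apply: le_trans.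
have w1' : 0 < 1 - w by rewrite subr_gt0.
have hN N k : `|c k * (q ^+ N) ^+ k| <= C * w ^+ k.
  rewrite normrM (le_trans _ (h k))// ler_piMr// !normrX exprn_ile1//.
  by rewrite exprn_ile1// ltW.
have bound N : `|limn (series (fun k => c k * (q ^+ N) ^+ k)) - c 0%N| <=
    `|q| ^+ N * (C / (1 - w)).
  have cN := geometric_dominated_cvg w01 (hN N).
  have -> : limn (series (fun k => c k * (q ^+ N) ^+ k)) - c 0%N =
      limn ((series (fun k => c k * (q ^+ N) ^+ k)) \- cst (c 0%N)).
    by apply/esym/cvg_lim => //; apply: cvgB => //; exact: cvg_cst.
  have cB : cvgn ((series (fun k => c k * (q ^+ N) ^+ k)) \- cst (c 0%N)).
    by apply: is_cvgB => //; exact: is_cvg_cst.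
  rewrite -lim_norm//; apply: limr_le; first exact: is_cvg_norm.
  exists 1%N => // n /= n1; rewrite /series /=.
  rewrite -(prednK n1) big_nat_recl// expr0 mulr1 addrAC subrr add0r.
  rewrite (le_trans (ler_norm_sum _ _ _))//.
  rewrite (le_trans (y := \sum_(0 <= i < n.-1) `|q| ^+ N * (C * w ^+ i)))//.
    apply: ler_sum => i _; rewrite normrM !normrX mulrC exprS -mulrA.
    rewrite ler_wpM2l ?exprn_ge0//.
    rewrite (le_trans (y := `|c i.+1|))//.
      by rewrite ler_piMl// exprn_ile1// ?exprn_ge0// exprn_ile1// ltW.
    rewrite (le_trans (h _))// ler_wpM2l// exprS ler_piMl ?exprn_ge0//.
    exact: ltW.
  rewrite -mulr_sumr ler_wpM2l ?exprn_ge0// -mulr_sumr ler_wpM2l//.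
  exact: geometric_sum_le.
apply/subr_cvg0; exact: cvg_geometric_bound q1 bound.
Qed.

Lemma cvg_mulr_const (P : nat -> R) (K l : R) : l != 0 ->
  P N * K @[N --> \oo] --> l -> K != 0 /\ P N @[N --> \oo] --> l / K.
Proof.
move=> l0 h.
have K0 : K != 0.
  apply: contra_neq l0 => K0; apply: cvg_unique h _ => //.
  rewrite (_ : (fun N => _) = cst 0); first exact: cvg_cst.
  by apply/funext => N; rewrite K0 mulr0.
split => //.
have -> : P = fun N => P N * K / K by apply/funext => N; rewrite mulfK.
exact: cvgMl.
Qed.

End Growth.

Section Euler.
Context {R : realType} (q : R).
Hypothesis hq : -1 < q < 1.
Implicit Types (a b : R) (n k : nat).

Lemma qpoch_inv_growth (u : R) : 1 < u ->
  exists2 C, 0 <= C & forall n, (qpoch q q n)^-1 <= C * u ^+ n.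
Proof.
move=> u1; have u0 : 0 < u by apply: lt_trans u1.
apply: geometric_growth => //.
have : \forall n \near \oo, q ^+ n < 1 - u^-1.
  apply: (cvgr_lt 0); first exact: cvg_expr (normq_lt1 hq).
  by rewrite subr_gt0 invf_lt1.
move=> [N _ hN]; exists N => // n /= Nn.
have P0 : 0 < qpoch q q n by rewrite qpoch_gt0// normq_lt1.
rewrite qpochS invfM mulrC ler_pM2r ?invr_gt0// -exprS.
have := hN n.+1 (leqW Nn); rewrite /= => h.
rewrite -[leRHS]invrK lef_pV2 ?posrE ?invr_gt0//.
  by rewrite lerBrDl -lerBrDr ltW.
by rewrite exprS subr1_Xq_gt0// normq_lt1.
Qed.

(** Room for a polynomial or subexponential factor: a rate still below 1 after
    multiplication by some [u > 1]. *)
Lemma subunit_rate (r : R) : `|r| < 1 ->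
  exists2 u, 1 < u & 0 <= u * `|r| < 1.
Proof.
move=> r1; have r0 := normr_ge0 r; have p : 0 < 1 + `|r| by rewrite ltr_wpDr.
(* The product of this [u] with [`|r|] is 2 |r| / (1 + |r|), below 1. *)
exists (2 / (1 + `|r|)); first by rewrite ltr_pdivlMr// mul1r; lra.
apply/andP; split; first by rewrite mulr_ge0// divr_ge0// ltW.
by rewrite mulrAC ltr_pdivrMr// mul1r; lra.
Qed.

(** Euler's series, the inverse of the infinite product [qpoch_oo q a]. *)
Definition qexp a : R := limn (series (fun k => a ^+ k / qpoch q q k)).

Lemma qexp_coef_bound a : `|a| < 1 -> exists C w, 0 <= w < 1 /\
  forall k, `|a ^+ k / qpoch q q k| <= C * w ^+ k.
Proof.
move=> /subunit_rate[u u1 w01]; have [C C0 hC] := qpoch_inv_growth u1.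
exists C, (u * `|a|); split => // k.
rewrite normrM normrX exprMn mulrC mulrA ler_wpM2r ?exprn_ge0//.
by rewrite ger0_norm// invr_ge0 ltW// qpoch_gt0// normq_lt1.
Qed.

(** On truncated series the identity fails by one term, of order [a ^+ n.+1]. *)
Lemma qexp_mul a : `|a| < 1 -> (1 - a) * qexp a = qexp (a * q).
Proof.
move=> a1.
have part n : (1 - a) * series (fun k => a ^+ k / qpoch q q k) n.+1 =
    series (fun k => (a * q) ^+ k / qpoch q q k) n.+1 - a ^+ n.+1 / qpoch q q n.
  rewrite /series /=; elim: n => [|n IH].
    by rewrite !big_nat1 !expr0 qpoch0; field.
  rewrite [in LHS]big_nat_recr//= [in RHS]big_nat_recr//= mulrDr IH qpochS.
  have P0 : qpoch q q n != 0 by rewrite gt_eqF// qpoch_gt0// normq_lt1.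
  have P1 : 1 - q * q ^+ n != 0 by rewrite gt_eqF// subr1_Xq_gt0// normq_lt1.
  by rewrite exprMn !exprS; field; rewrite P0 P1.
have aq1 : `|a * q| < 1.
  by rewrite normrM mulr_ilt1// normq_lt1.
have [C [w [w01 h]]] := qexp_coef_bound a1.
have [C' [w' [w01' h']]] := qexp_coef_bound aq1.
have cv := geometric_dominated_cvg w01 h.
have cv' := geometric_dominated_cvg w01' h'.
have L1 : (1 - a) * series (fun k => a ^+ k / qpoch q q k) n.+1
    @[n --> \oo] --> (1 - a) * qexp a.
  by apply: cvgMr; rewrite cvg_shiftS.
have L2 : (1 - a) * series (fun k => a ^+ k / qpoch q q k) n.+1
    @[n --> \oo] --> qexp (a * q).
  under eq_fun do rewrite part.
  rewrite -(subr0 (qexp (a * q))); apply: cvgB; first by rewrite cvg_shiftS.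
  have [w0 w1] := andP w01.
  apply: (@cvg_geometric_bound _ _ w (`|a| * C)) => [|n].
    by rewrite ger0_norm.
  rewrite exprS -mulrA normrM (ger0_norm w0) mulrCA ler_wpM2l// (mulrC (w ^+ n)).
  exact: h.
exact: cvgn_unique L1 L2.
Qed.

Lemma qpoch_qexp a n : `|a| < 1 -> qpoch q a n * qexp a = qexp (a * q ^+ n).
Proof.
move=> a1; elim: n => [|n IH]; first by rewrite qpoch0 expr0 mulr1 mul1r.
rewrite qpochS mulrAC IH mulrC qexp_mul; first by rewrite exprSr mulrA.
by rewrite normrM (le_lt_trans _ a1)// ler_piMr// normqX_le.
Qed.

(** By [qpoch_qexp] the product of [qpoch q a N] and [qexp a] is Euler's series at
    [a * q ^+ N], which tends to 1. Hence [qexp a] does not vanish, and neither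
    does the limit of [qpoch q a N]. *)
Lemma qpoch_cvg a : `|a| < 1 ->
  qpoch q a N @[N --> \oo] --> qpoch_oo q a /\ 0 < qpoch_oo q a.
Proof.
move=> a1; have [C [w [w01 h]]] := qexp_coef_bound a1.
have := pseries_cvg0 (normq_lt1 hq) w01 h.
under eq_fun.
  move=> N.
  rewrite (_ : (fun k => _) = fun k => (a * q ^+ N) ^+ k / qpoch q q k); last first.
    by apply/funext => k; rewrite exprMn mulrAC.
  rewrite -/(qexp (a * q ^+ N)) -qpoch_qexp//.
  over.
rewrite expr0 qpoch0 divr1 => /cvg_mulr_const -/(_ (oner_neq0 _)) [K0 cv].
have E : qpoch_oo q a = 1 / qexp a by exact/cvg_lim.
split; first by rewrite E.
rewrite lt_neqAle eq_sym {1}E mulf_neq0 ?invr_eq0//=.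
apply: limr_ge; first by apply/cvg_ex; eexists; exact: cv.
by apply: nearW => n; rewrite ltW// qpoch_gt0.
Qed.

End Euler.

(** * The support, and the growth of q-Hermite polynomials on it *)

Lemma ler_norm_sqr {R : realDomainType} (a b : R) :
  (`|a| <= `|b|) = (a ^+ 2 <= b ^+ 2).
Proof.
rewrite -(real_normK (num_real a)) -(real_normK (num_real b)).
by rewrite ler_pXn2r// nnegrE normr_ge0.
Qed.

Section Support.
Context {R : realType} (q : R).
Hypothesis hq : -1 < q < 1.
Implicit Types (x y rho : R).

Lemma suppP x : reflect (supp q x) ((1 - q) * x ^+ 2 <= 4).
Proof.
have k0 : 0 < 1 - q by case/andP: hq => _; rewrite subr_gt0.
have s0 : 0 < Num.sqrt (1 - q) by rewrite sqrtr_gt0.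
have -> : ((1 - q) * x ^+ 2 <= 4) =
    (- (2 / Num.sqrt (1 - q)) <= x <= 2 / Num.sqrt (1 - q)).
  rewrite -ler_norml ler_pdivlMr// -[X in _ = (_ * X <= _)](gtr0_norm s0) -normrM.
  rewrite -[X in _ = (_ <= X)](ger0_norm (ler0n R 2)) ler_norm_sqr exprMn.
  rewrite (sqr_sqrtr (ltW k0)) mulrC.
  by have -> : (4 : R) = 2 ^+ 2 by rewrite expr2; ring.
by rewrite /supp set_itvcc; exact: idP.
Qed.

Lemma lq_ge0 x rho : supp q x -> `|rho| <= 1 -> 0 <= lq q x rho.
Proof.
move=> /suppP hx hr; rewrite /lq.
have [r0|r0] := leP 0 rho; last first.
  rewrite addr_ge0 ?sqr_ge0// oppr_ge0 mulrAC mulr_ge0_le0//; last exact: ltW.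
  by rewrite mulr_ge0 ?sqr_ge0// subr_ge0 ltW//; case/andP: hq.
rewrite (ger0_norm r0) in hr.
have : (1 - q) * rho * x ^+ 2 <= 4 * rho by rewrite mulrAC ler_wpM2r.
by have := sqr_ge0 (1 - rho); rewrite !expr2; lra.
Qed.

Lemma omegaqxx x rho : omegaq q x x rho = (1 - rho) ^+ 2 * lq q x rho.
Proof. by rewrite /omegaq /lq; ring. Qed.

(** One has |1 + rho^2 - 2 rho c d| >= 2 |rho| (1 - |c d|), and
    (1 - c^2) (1 - d^2) <= (1 - |c d|)^2. *)
Lemma cos_product_ge0 rho c d : c ^+ 2 <= 1 -> d ^+ 2 <= 1 ->
  0 <= (1 + rho ^+ 2 - 2 * (rho * (c * d))) ^+ 2
   - (2 * rho) ^+ 2 * ((1 - c ^+ 2) * (1 - d ^+ 2)).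
Proof.
move=> hc hd; rewrite subr_ge0.
have c1 : `|c| <= 1 by rewrite -(normr1 R) ler_norm_sqr expr1n.
have d1 : `|d| <= 1 by rewrite -(normr1 R) ler_norm_sqr expr1n.
have h1 : (1 - c ^+ 2) * (1 - d ^+ 2) <= (1 - `|c| * `|d|) ^+ 2.
  rewrite -(real_normK (num_real c)) -(real_normK (num_real d)).
  by have := sqr_ge0 (`|c| - `|d|); rewrite !expr2; lra.
have e1 : `|c| * `|d| <= 1 by rewrite mulr_ile1.
have hr : rho * (c * d) <= `|rho| * (`|c| * `|d|).
  by rewrite (le_trans (ler_norm _))// !normrM.
move: h1 e1 hr; move: (`|c| * `|d|) => e h1 e1 hr.
apply: (@le_trans _ _ ((2 * rho) ^+ 2 * (1 - e) ^+ 2)).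
  by rewrite ler_wpM2l// sqr_ge0.
rewrite -exprMn -ler_norm_sqr normrM [`|1 - e|]ger0_norm ?subr_ge0//.
have r0 := sqr_ge0 (1 - `|rho|).
have r2 : rho ^+ 2 = `|rho| ^+ 2 by rewrite real_normK// num_real.
have re : `|rho| * e <= `|rho| by rewrite ler_piMr.
rewrite normrM (ger0_norm (ler0n R 2)).
by rewrite [leRHS]ger0_norm r2; move: r0; rewrite !expr2; lra.
Qed.

(** For [x], [y] proportional to the cosines of two angles, [omegaq] is the
    product of the squared moduli of [1 - rho * e ^ i t], where [t] is the sum,
    respectively the difference, of the angles; multiplied out, it is the
    expression of [cos_product_ge0]. *)
Lemma omega_ge0 x y rho : supp q x -> supp q y -> 0 <= omegaq q x y rho.
Proof.
move=> /suppP hx /suppP hy.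
have k0 : 0 < 1 - q by case/andP: hq => _; rewrite subr_gt0.
have sk : Num.sqrt (1 - q) ^+ 2 = 1 - q by rewrite sqr_sqrtr// ltW.
have hs z : (1 - q) * z ^+ 2 <= 4 -> (Num.sqrt (1 - q) * z / 2) ^+ 2 <= 1.
  by move=> hz; rewrite !exprMn sk exprVn ler_pdivrMr ?mul1r//; lra.
have := cos_product_ge0 rho (hs _ hx) (hs _ hy).
congr (0 <= _); rewrite /omegaq !exprMn sk.
rewrite (_ : _ * (_ * _ / 2 * _) = rho * ((1 - q) * x * y / 4)); last first.
  by rewrite -[in RHS]sk; field.
by field.
Qed.

End Support.

Section Bound.
Context {R : realType} (q : R).
Hypothesis hq : -1 < q < 1.
Implicit Types (x y t : R) (n : nat).
Local Notation H := (qhermite q).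

(** The pair majorizes, uniformly on the support, the scaled polynomial
    h_n = (1 - q)^(n/2) H_n(x) and the square root of the quadratic form Q of
    [qhermite_le_majorant] at (h_(n+1), h_n). *)
Fixpoint majorant n : R * R :=
  if n is n'.+1 then
    let: (X, G) := majorant n' in (X + G, G + `|q| ^+ n * X)
  else (1, 1).

Lemma majorant_ge0 n : 0 <= (majorant n).1 /\ 0 <= (majorant n).2.
Proof.
elim: n => [|n [IH1 IH2]]; first by [].
rewrite /=; case: (majorant n) IH1 IH2 => X G /= X0 G0.
by rewrite !addr_ge0// mulr_ge0// exprn_ge0.
Qed.

Let s : R := Num.sqrt (1 - q).

(** With h_n as above and x = 2 y / (1 - q)^(1/2), the recurrence reads
    h_(n+2) = 2 y h_(n+1) - h_n + q^(n+1) h_n. For q = 0 it preserves the form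
    Q(a, b) = a^2 - 2 y a b + b^2, which is positive since |y| <= 1; the last term
    increases the square root of Q by at most |q|^(n+1) |h_n|. *)
Lemma qhermite_le_majorant x n : supp q x ->
  `|s ^+ n * (H n).[x]| <= (majorant n).1.
Proof.
move=> /(suppP hq) hx.
have k0 : 0 <= 1 - q by case/andP: hq => _ /ltW; rewrite subr_ge0.
have s2 : s ^+ 2 = 1 - q by rewrite sqr_sqrtr.
pose y := s * x / 2.
have hy : y ^+ 2 <= 1 by rewrite /y !exprMn s2 exprVn ler_pdivrMr ?mul1r//; lra.
pose h n := s ^+ n * (H n).[x].
have h0 : h 0%N = 1 by rewrite /h expr0 mul1r hornerC.
have h1 : h 1%N = 2 * y by rewrite /h expr1 qhermite1 hornerX /y; field.
have hS m : h m.+2 = 2 * y * h m.+1 - (1 - q ^+ m.+1) * h m.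
  rewrite /h qhermiteSS hornerD hornerN hornerM hornerX hornerZ -(qnatE q m.+1).
  by rewrite -s2 /y !exprS expr0 mulr1; field.
clearbody y; pose Q a b := a ^+ 2 - 2 * y * (a * b) + b ^+ 2.
have Qsq a b : Q a b = (a - y * b) ^+ 2 + (1 - y ^+ 2) * b ^+ 2.
  by rewrite /Q; ring.
have Q_ge a b (G : R) : 0 <= G -> Q a b <= G ^+ 2 -> `|a| <= `|b| + G.
  move=> G0 hQ.
  have y1 : `|y| <= 1 by rewrite -(normr1 R) ler_norm_sqr expr1n.
  have : (`|a| - `|b|) ^+ 2 <= G ^+ 2.
    have : y * (a * b) <= `|a| * `|b|.
      by rewrite (le_trans (ler_norm _))// !normrM ler_piMl ?mulr_ge0.
    move=> hab; apply: le_trans hQ; rewrite /Q -(real_normK (num_real a)).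
    by rewrite -(real_normK (num_real b)) !expr2; lra.
  rewrite -ler_norm_sqr (ger0_norm G0) => /(le_trans (ler_norm _)).
  by rewrite lerBlDl.
have Q_step a b e (G : R) : 0 <= G -> Q a b <= G ^+ 2 ->
    Q (a + e) b <= (G + `|e|) ^+ 2.
  move=> G0 hQ.
  have hab : `|a - y * b| <= G.
    rewrite -(ger0_norm G0) ler_norm_sqr (le_trans _ hQ)// Qsq lerDl.
    by rewrite mulr_ge0 ?sqr_ge0// subr_ge0.
  have -> : Q (a + e) b = Q a b + 2 * (e * (a - y * b)) + e ^+ 2.
    by rewrite /Q; ring.
  have he : e * (a - y * b) <= G * `|e|.
    by rewrite (le_trans (ler_norm _))// normrM mulrC ler_wpM2r.
  have -> : (G + `|e|) ^+ 2 = G ^+ 2 + 2 * (G * `|e|) + e ^+ 2.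
    by rewrite -(real_normK (num_real e)); ring.
  by lra.
suff [//] : `|h n| <= (majorant n).1 /\ Q (h n.+1) (h n) <= (majorant n).2 ^+ 2.
elim: n => [|n [IH1 IH2]].
  by rewrite h1 h0 normr1 /Q /=; split => //; lra.
have [X0 G0] := majorant_ge0 n.
rewrite /=; case: (majorant n) IH1 IH2 X0 G0 => X G /= IH1 IH2 X0 G0; split.
  by rewrite (le_trans (Q_ge _ _ _ G0 IH2))// lerD2r.
rewrite hS (_ : 2 * y * _ - _ = (2 * y * h n.+1 - h n) + q ^+ n.+1 * h n); last first.
  by ring.
have : Q (2 * y * h n.+1 - h n) (h n.+1) <= G ^+ 2.
  by rewrite (le_trans _ IH2)// /Q; lra.
move=> /(Q_step _ _ (q ^+ n.+1 * h n) _ G0) /le_trans; apply.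
have e0 : `|q ^+ n.+1 * h n| <= `|q| ^+ n.+1 * X.
  by rewrite normrM normrX ler_wpM2l// exprn_ge0.
by rewrite ler_pXn2r// ?nnegrE ?addr_ge0 ?mulr_ge0 ?exprn_ge0// lerD2l.
Qed.

(** The linear combination X + G / (t - 1) of the two majorants grows by a factor
    at most t as soon as |q|^(n+1) <= (t - 1)^2. *)
Lemma majorant_growth t : 1 < t ->
  exists2 C, 0 <= C & forall n, (majorant n).1 <= C * t ^+ n.
Proof.
move=> t1; have t0 : 0 < t by apply: lt_trans t1.
have e0 : 0 < t - 1 by rewrite subr_gt0.
have [|C C0 hC] := @geometric_growth R
  (fun n => (majorant n).1 + (majorant n).2 / (t - 1)) t t0.
  have : \forall n \near \oo, `|q| ^+ n < (t - 1) ^+ 2.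
    apply: (cvgr_lt 0); last by rewrite exprn_gt0.
    by apply: cvg_expr; rewrite normr_id normq_lt1.
  move=> [N _ hN]; exists N => // n /= Nn.
  have [] := majorant_ge0 n; case: (majorant n) => X G /= X0 G0.
  have := hN n.+1 (leqW Nn); rewrite /= => hqn.
  have : `|q| ^+ n.+1 * X / (t - 1) <= (t - 1) * X.
    by rewrite ler_pdivrMr// mulrAC -expr2 ler_wpM2r// ltW.
  move=> h; rewrite (mulrDl _ _ (t - 1)^-1).
  have -> : t * (X + G / (t - 1)) = X + G + (G / (t - 1) + (t - 1) * X).
    by field; rewrite gt_eqF.
  by rewrite lerD// lerD.
exists C => // n; apply: le_trans (hC n).
by rewrite lerDl divr_ge0// ?(majorant_ge0 n).2// ltW.
Qed.

End Bound.

(** * The Poisson-Mehler kernel *)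

Section Mehler.
Context {R : realType} (q : R).
Hypothesis hq : -1 < q < 1.
Implicit Types (x y rho : R) (n k m : nat).
Local Notation H := (qhermite q).

Definition mehler_coef x y k : R := (H k).[x] * (H k).[y] / qfact q k.

Definition mehler rho x y : R := limn (series (fun k => mehler_coef x y k * rho ^+ k)).

Lemma qpoch_qE k : qpoch q q k = (1 - q) ^+ k * qfact q k.
Proof.
elim: k => [|k IH]; first by rewrite qpoch0 qfact0 mulr1.
by rewrite qpochS IH qfactS (qnat_def hq) !exprS; field; rewrite subr1q_neq0.
Qed.

Lemma cube_root_gt1 (u : R) : 1 < u -> exists2 t, 1 < t & t ^+ 3 <= u.
Proof.
move=> u1.
(* For e <= 1 one has (1 + e)^3 <= 1 + 7 e. *)
pose e := Num.min (u - 1) 1 / 7.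
have e0 : 0 < e by rewrite divr_gt0// lt_min subr_gt0 u1 ltr01.
have e1 : e <= (u - 1) / 7 by rewrite ler_pM2r// ge_min lexx.
have e2 : e <= 1 / 7 by rewrite ler_pM2r// ge_min lexx orbT.
exists (1 + e); first by rewrite ltrDl.
have -> : (1 + e) ^+ 3 = 1 + 3 * e + 3 * (e * e) + e * (e * e) by ring.
have ee : e * e <= e by rewrite ler_piMr; lra.
have eee : e * (e * e) <= e by rewrite ler_piMr; lra.
by clearbody e; lra.
Qed.

(** Each of the two polynomials and the inverse of [qpoch q q k] contribute a
    factor [t ^+ k], whence the cube root of [u]. *)
Lemma mehler_coef_bound (u : R) : 1 < u -> exists2 C, 0 <= C &
  forall x y k, supp q x -> supp q y -> `|mehler_coef x y k| <= C * u ^+ k.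
Proof.
move=> /cube_root_gt1[t t1 tu]; have t0 : 0 <= t by rewrite (le_trans _ (ltW t1)).
have [C1 C10 h1] := majorant_growth hq t1.
have [C2 C20 h2] := qpoch_inv_growth hq t1.
exists (C1 * C1 * C2); first by rewrite !mulr_ge0.
move=> x y k hx hy.
have bx := le_trans (qhermite_le_majorant hq k hx) (h1 k).
have by_ := le_trans (qhermite_le_majorant hq k hy) (h1 k).
have k0 : 0 < 1 - q by case/andP: hq => _; rewrite subr_gt0.
have -> : mehler_coef x y k = (Num.sqrt (1 - q) ^+ k * (H k).[x]) *
    (Num.sqrt (1 - q) ^+ k * (H k).[y]) * (qpoch q q k)^-1.
  rewrite qpoch_qE mulrACA -exprMn -expr2 sqr_sqrtr ?(ltW k0)// /mehler_coef.
  by field; rewrite qfact_neq0// expf_neq0// gt_eqF.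
have bz : `|(qpoch q q k)^-1| <= C2 * t ^+ k.
  by rewrite ger0_norm// invr_ge0 ltW// qpoch_gt0// normq_lt1.
apply: (@le_trans _ _ ((C1 * t ^+ k) * (C1 * t ^+ k) * (C2 * t ^+ k))).
  rewrite normrM [X in X * _]normrM.
  by apply: ler_pM => //; apply: ler_pM.
rewrite (_ : _ * _ * _ = C1 * C1 * C2 * (t ^+ 3) ^+ k); last first.
  by rewrite !exprS expr0 !exprMn expr1n; ring.
rewrite ler_wpM2l ?mulr_ge0// lerXn2r// nnegrE ?exprn_ge0//.
by rewrite (le_trans _ tu)// exprn_ge0.
Qed.

Lemma mehler_coef_geometric rho : `|rho| < 1 -> exists C w, [/\ 0 <= C, 0 <= w < 1 &
  forall x y k, supp q x -> supp q y -> `|mehler_coef x y k * rho ^+ k| <= C * w ^+ k].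
Proof.
move=> /subunit_rate[u u1 w01]; have [C C0 hC] := mehler_coef_bound u1.
exists C, (u * `|rho|); split => // x y k hx hy.
by rewrite normrM normrX exprMn mulrA ler_wpM2r ?exprn_ge0// hC.
Qed.

(* As a polynomial in [rho], [omegaq] has the coefficients 1, b1, b2, b1, 1. *)
Let b1 x y : R := - ((1 - q) * x * y).
Let b2 x y : R := (1 - q) * (x ^+ 2 + y ^+ 2) - 2.

(** Coefficient of [rho ^+ m.+4] in the functional equation [mehler_mul];
    [mehler_coef_rec1], [mehler_coef_rec2] and [mehler_coef_rec3] are those of
    lower order. *)
Lemma mehler_coef_rec x y m :
  mehler_coef x y m.+4 * (1 - q ^+ 4 * q ^+ m) + b1 x y * mehler_coef x y m.+3
  + (b2 x y + (1 + q) * q ^+ 2 * q ^+ m) * mehler_coef x y m.+2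
  + b1 x y * mehler_coef x y m.+1 + (1 - q * q ^+ m) * mehler_coef x y m = 0.
Proof.
rewrite /mehler_coef !qhermiteSS.
rewrite !(hornerD, hornerN, hornerM, hornerZ, hornerX) !qfactS /b1 /b2.
have P n : 1 - q * q ^+ n != 0.
  by rewrite gt_eqF// subr1_Xq_gt0// normq_lt1.
have := P m.+3; have := P m.+2; have := P m.+1; have := P m.
rewrite !(qnat_def hq) !exprS expr0 !mulr1.
move: (q ^+ m) (qfact_neq0 hq m) => Q; move: (qfact q m) => F F0.
move: ((H m).[x]) ((H m.+1).[x]) ((H m).[y]) ((H m.+1).[y]) => a0 a1 c0 c1.
move=> h0 h1 h2 h3.
by field; rewrite F0 h0 h1 h2 h3 subr1q_neq0.
Qed.

Lemma mehler_coef_rec1 x y : (1 - q) * mehler_coef x y 1 + b1 x y * mehler_coef x y 0 = 0.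
Proof.
rewrite /mehler_coef qhermite1 qhermite0 !hornerX !hornerC qfactS qfact0 qnat1 /b1.
by field.
Qed.

Lemma mehler_coef_rec2 x y : (1 - q ^+ 2) * mehler_coef x y 2 + b1 x y * mehler_coef x y 1
  + (b2 x y + (1 + q)) * mehler_coef x y 0 = 0.
Proof.
rewrite /mehler_coef !qhermiteSS qhermite1 qhermite0.
rewrite !(hornerD, hornerN, hornerM, hornerZ, hornerX, hornerC).
rewrite !qfactS qfact0 qnat1 /b1 /b2.
have := qnat_neq0 hq 1; rewrite (qnat_def hq) => h.
have : 1 - q ^+ 2 != 0 by apply: contraNneq h => ->; rewrite mul0r.
by move=> h2; field; rewrite subr1q_neq0.
Qed.

Lemma mehler_coef_rec3 x y : (1 - q ^+ 3) * mehler_coef x y 3 + b1 x y * mehler_coef x y 2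
  + (b2 x y + (1 + q) * q) * mehler_coef x y 1 + b1 x y * mehler_coef x y 0 = 0.
Proof.
rewrite /mehler_coef !qhermiteSS qhermite1 qhermite0.
rewrite !(hornerD, hornerN, hornerM, hornerZ, hornerX, hornerC).
rewrite !qfactS qfact0 qnat1 /b1 /b2.
have := qnat_neq0 hq 2; have := qnat_neq0 hq 1; rewrite !(qnat_def hq) => h h'.
have h2 : 1 - q ^+ 2 != 0 by apply: contraNneq h => ->; rewrite mul0r.
have h3 : 1 - q ^+ 3 != 0 by apply: contraNneq h' => ->; rewrite mul0r.
by field; rewrite subr1q_neq0 ?h2 ?h3.
Qed.

(** Truncating the series at order [m + 4] leaves these boundary terms in the
    functional equation; each carries a factor [rho ^+ k] with [k >= m + 4]. *)
Let mehler_rest rho x y m : R :=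
  let v k := mehler_coef x y k * rho ^+ k in let Q := q ^+ m in
  (rho * b1 x y + rho ^+ 2 * (b2 x y + (1 + q) * q ^+ 3 * Q)
     + rho ^+ 3 * b1 x y + rho ^+ 4 * (1 - q ^+ 4 * Q)) * v m.+3
  + (rho ^+ 2 * (b2 x y + (1 + q) * q ^+ 2 * Q)
     + rho ^+ 3 * b1 x y + rho ^+ 4 * (1 - q ^+ 3 * Q)) * v m.+2
  + (rho ^+ 3 * b1 x y + rho ^+ 4 * (1 - q ^+ 2 * Q)) * v m.+1
  + rho ^+ 4 * (1 - q * Q) * v m.

Lemma mehler_partial rho x y m :
  omegaq q x y rho * series (fun k => mehler_coef x y k * rho ^+ k) (m + 4)%N =
  (1 - rho ^+ 2) * (1 - q * rho ^+ 2) *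
    series (fun k => mehler_coef x y k * (rho * q) ^+ k) (m + 4)%N
  + mehler_rest rho x y m.
Proof.
have omE : omegaq q x y rho = 1 + b1 x y * rho + b2 x y * rho ^+ 2 +
    b1 x y * rho ^+ 3 + rho ^+ 4 by rewrite /omegaq /b1 /b2; ring.
elim: m => [|m IH].
  rewrite /series /= !big_nat_recr//= !big_geq// /mehler_rest omE expr0.
  have [A1 [r1 d1]] : exists A, A = 0 /\ A =
    (1 - q) * mehler_coef x y 1 + b1 x y * mehler_coef x y 0.
    by eexists; rewrite mehler_coef_rec1.
  have [A2 [r2 d2]] : exists A, A = 0 /\ A =
    (1 - q ^+ 2) * mehler_coef x y 2 + b1 x y * mehler_coef x y 1
    + (b2 x y + (1 + q)) * mehler_coef x y 0.
    by eexists; rewrite mehler_coef_rec2.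
  have [A3 [r3 d3]] : exists A, A = 0 /\ A =
    (1 - q ^+ 3) * mehler_coef x y 3 + b1 x y * mehler_coef x y 2
    + (b2 x y + (1 + q) * q) * mehler_coef x y 1 + b1 x y * mehler_coef x y 0.
    by eexists; rewrite mehler_coef_rec3.
  apply/eqP; rewrite -subr_eq0; apply/eqP.
  transitivity (rho * A1 + rho ^+ 2 * A2 + rho ^+ 3 * A3).
    by rewrite d1 d2 d3; ring.
  by rewrite r1 r2 r3; ring.
rewrite addSn !seriesSr !mulrDr IH.
have rec := mehler_coef_rec x y m.
apply/eqP; rewrite -subr_eq0; apply/eqP.
transitivity (rho ^+ m.+4 * (0 : R)); last by rewrite mulr0.
rewrite -rec omE /mehler_rest addn4 exprMn !exprS.
by ring.
Qed.

(** The q-difference equation of the kernel, equivalent to the recurrences for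
    its coefficients. *)
Lemma mehler_mul rho x y : `|rho| < 1 -> supp q x -> supp q y ->
  omegaq q x y rho * mehler rho x y =
  (1 - rho ^+ 2) * (1 - q * rho ^+ 2) * mehler (rho * q) x y.
Proof.
move=> r1 hx hy.
have rq1 : `|rho * q| < 1 by rewrite normrM mulr_ilt1// normq_lt1.
have [C [w [C0 w01 h]]] := mehler_coef_geometric r1.
have [C' [w' [_ w01' h']]] := mehler_coef_geometric rq1.
have cv := geometric_dominated_cvg w01 (fun k => h x y k hx hy).
have cv' := geometric_dominated_cvg w01' (fun k => h' x y k hx hy).
pose v k := mehler_coef x y k * rho ^+ k.
have v0 i : v (m + i)%N @[m --> \oo] --> 0.
  by rewrite cvg_shiftn; exact: cvg_series_cvg_0.
have q0 (a b : R) : a + b * q ^+ m @[m --> \oo] --> a.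
  have : a + b * q ^+ m @[m --> \oo] --> a + b * 0.
    apply: cvgD; first exact: cvg_cst.
    by apply: cvgMr; apply: cvg_expr; exact: normq_lt1.
  by rewrite mulr0 addr0.
have q0v (a b : R) i : (a + b * q ^+ m) * v (m + i)%N @[m --> \oo] --> 0.
  have : (a + b * q ^+ m) * v (m + i)%N @[m --> \oo] --> a * 0 by exact: cvgM.
  by rewrite mulr0.
have rest0 : mehler_rest rho x y m @[m --> \oo] --> 0.
  have -> : mehler_rest rho x y = fun m =>
    (rho * b1 x y + rho ^+ 2 * b2 x y + rho ^+ 3 * b1 x y + rho ^+ 4
      + (rho ^+ 2 * (1 + q) * q ^+ 3 - rho ^+ 4 * q ^+ 4) * q ^+ m) * v (m + 3)%N
    + (rho ^+ 2 * b2 x y + rho ^+ 3 * b1 x y + rho ^+ 4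
      + (rho ^+ 2 * (1 + q) * q ^+ 2 - rho ^+ 4 * q ^+ 3) * q ^+ m) * v (m + 2)%N
    + (rho ^+ 3 * b1 x y + rho ^+ 4 + (- rho ^+ 4 * q ^+ 2) * q ^+ m) * v (m + 1)%N
    + (rho ^+ 4 + (- rho ^+ 4 * q) * q ^+ m) * v (m + 0)%N.
    by apply/funext => m; rewrite /mehler_rest /v addn3 addn2 addn1 addn0; ring.
  rewrite [X in _ --> X](_ : 0 = 0 + 0 + 0 + 0); last by rewrite !addr0.
  by do 3 (apply: cvgD; last exact: q0v).
have L1 : omegaq q x y rho * series v (m + 4)%N @[m --> \oo]
    --> omegaq q x y rho * mehler rho x y.
  by apply: cvgMr; rewrite cvg_shiftn.
have L2 : omegaq q x y rho * series v (m + 4)%N @[m --> \oo]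
    --> (1 - rho ^+ 2) * (1 - q * rho ^+ 2) * mehler (rho * q) x y + 0.
  under eq_fun do rewrite mehler_partial.
  by apply: cvgD => //; apply: cvgMr; rewrite cvg_shiftn.
by rewrite (cvgn_unique L1 L2) addr0.
Qed.

Lemma mehler_prod rho x y n : `|rho| < 1 -> supp q x -> supp q y ->
  (\prod_(0 <= i < n) omegaq q x y (rho * q ^+ i)) * mehler rho x y =
  qpoch q (rho ^+ 2) (2 * n) * mehler (rho * q ^+ n) x y.
Proof.
move=> r1 hx hy; elim: n => [|n IH].
  by rewrite big_geq// muln0 qpoch0 expr0 mulr1.
have rn1 : `|rho * q ^+ n| < 1.
  by rewrite normrM (le_lt_trans _ r1)// ler_piMr// normqX_le.
rewrite big_nat_recr//= mulrAC IH mulrAC -mulrA.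
rewrite mehler_mul// -[rho * q ^+ n * q]mulrA -exprSr.
rewrite mulnS !addSn add0n !qpochS mul2n -addnn !exprS exprD.
by ring.
Qed.

(** The Poisson-Mehler formula. In [mehler_prod] the right-hand side tends to
    [(rho^2)_oo * 1], because [rho * q ^+ n] tends to 0; as this limit is not
    zero, neither is the kernel, and the partial products converge. *)
Lemma mehler_cvg rho x y : `|rho| < 1 -> supp q x -> supp q y ->
  mehler rho x y != 0 /\
  \prod_(0 <= i < N) omegaq q x y (rho * q ^+ i) @[N --> \oo]
    --> qpoch_oo q (rho ^+ 2) / mehler rho x y.
Proof.
move=> r1 hx hy.
have r21 : `|rho ^+ 2| < 1 by rewrite normrX exprn_ilt1.
have [cp p0] := qpoch_cvg hq r21.
apply: cvg_mulr_const; first by rewrite gt_eqF.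
under eq_fun do rewrite mehler_prod//.
rewrite -(mulr1 (qpoch_oo q (rho ^+ 2))); apply: cvgM; first exact: cvg_double cp.
have [C [w [C0 w01 h]]] := mehler_coef_geometric r1.
have := pseries_cvg0 (normq_lt1 hq) w01 (fun k => h x y k hx hy).
rewrite expr0 mulr1 /mehler_coef qhermite0 !hornerC qfact0 mulr1 divr1.
rewrite (_ : (fun N => _) = fun N => mehler (rho * q ^+ N) x y)//.
apply/funext => N; congr (limn (series _)).
by apply/funext => k; rewrite exprMn mulrA.
Qed.

(** The kernel is the inverse of a limit of products of nonnegative factors, up
    to the positive factor [(rho^2)_oo]. *)
Lemma mehler_ge0 rho x y : `|rho| < 1 -> supp q x -> supp q y ->
  0 <= mehler rho x y.
Proof.
move=> r1 hx hy.
have r21 : `|rho ^+ 2| < 1 by rewrite normrX exprn_ilt1.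
have [_ p0] := qpoch_cvg hq r21.
have [K0 cv] := mehler_cvg r1 hx hy.
have : 0 <= qpoch_oo q (rho ^+ 2) / mehler rho x y.
  rewrite -(cvg_lim _ cv)//; apply: limr_ge; first by apply/cvg_ex; eexists; exact: cv.
  by apply: nearW => N; apply: prodr_ge0 => i _; exact: omega_ge0.
by rewrite pmulr_rge0// invr_ge0.
Qed.

End Mehler.

(** * Cauchy products and the q-binomial series *)

Section Triangle_sums.
Context {R : realType}.
Implicit Types (u v : nat -> R).

(** Partial sums, by total degree, of the Cauchy product of two series. *)
Definition triangle_sum u v N : R :=
  \sum_(0 <= s < N) \sum_(0 <= k < s.+1) u k * v (s - k)%N.

Lemma triangle_sumE u v N :
  triangle_sum u v N = \sum_(0 <= k < N) u k * series v (N - k)%N.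
Proof.
rewrite /triangle_sum; elim: N => [|N IH]; first by rewrite !big_geq.
rewrite big_nat_recr//= IH [in RHS]big_nat_recr//= [X in _ + X]big_nat_recr//=.
rewrite addrA subnn -[N.+1]addn1 addnC addnK /series /= big_nat1; congr (_ + _).
rewrite -big_split /=; apply: eq_big_nat => k /andP[_ kN].
by rewrite add1n subSn ?(ltnW kN)// big_nat_recr//= mulrDr.
Qed.

Variables (u v : nat -> R) (C w : R).
Hypothesis (w01 : 0 <= w < 1).
Hypothesis (hu : forall k, `|u k| <= C * w ^+ k).
Hypothesis (hv : forall k, `|v k| <= C * w ^+ k).

Let w0 : 0 <= w. Proof. by case/andP: w01. Qed.
Let C0 : 0 <= C.
Proof. by have := hu 0%N; rewrite expr0 mulr1; apply: le_trans. Qed.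
Let w1' : 0 < 1 - w. Proof. by case/andP: w01 => _; rewrite subr_gt0. Qed.

Lemma geometric_partial_le m n : `|\sum_(m <= k < n) v k| <= C * w ^+ m / (1 - w).
Proof.
have [nm|mn] := leqP n m.
  by rewrite big_geq// normr0 divr_ge0 ?mulr_ge0 ?exprn_ge0 ?(ltW w1').
rewrite (le_trans (ler_norm_sum _ _ _))//.
rewrite -{1}(add0n m) big_addn.
apply: (@le_trans _ _ (\sum_(0 <= i < n - m) C * w ^+ m * w ^+ i)).
  apply: ler_sum => i _; rewrite -mulrA -exprD addnC.
  exact: hv.
rewrite -mulr_sumr ler_wpM2l ?mulr_ge0 ?exprn_ge0//.
exact: geometric_sum_le.
Qed.

Lemma triangle_sum_bound N : `|triangle_sum u v N| <= (C / (1 - w)) ^+ 2.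
Proof.
rewrite triangle_sumE (le_trans (ler_norm_sum _ _ _))//.
apply: (@le_trans _ _ (\sum_(0 <= k < N) C * w ^+ k * (C / (1 - w)))).
  apply: ler_sum => k _; rewrite normrM ler_pM//.
  by have := geometric_partial_le 0 (N - k); rewrite expr0 mulr1.
rewrite -mulr_suml -mulr_sumr expr2 ler_wpM2r//.
  by rewrite divr_ge0 ?(ltW w1').
by rewrite ler_wpM2l// geometric_sum_le.
Qed.

(** The missing part of the square of side [N] is at most [N%:R * w ^+ N] times a
    constant. *)
Lemma triangle_sum_cvg :
  triangle_sum u v @ \oo --> limn (series u) * limn (series v).
Proof.
have cu := geometric_dominated_cvg w01 hu.
have cv := geometric_dominated_cvg w01 hv.
have -> : triangle_sum u v = fun N => series u N * series v N -
    \sum_(0 <= k < N) u k * \sum_((N - k)%N <= j < N) v j.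
  apply/funext => N; rewrite triangle_sumE /series /= mulr_suml -sumrB.
  apply: eq_big_nat => k /andP[_ kN]; rewrite -mulrBr; congr (_ * _).
  by rewrite [X in _ = X - _](big_cat_nat (n := (N - k)%N)) ?leq_subr//= addrK.
rewrite -[X in _ --> X]subr0; apply: cvgB; first exact: cvgM.
(* Absorb the factor [n] into a slightly larger geometric rate. *)
have [t t1 [C' C'0 hC]] : exists2 t, 0 <= t < 1 &
    exists2 C', 0 <= C' & forall n, n%:R * w ^+ n <= C' * t ^+ n.
  exists ((1 + w) / 2).
    by case/andP: w01 => *; apply/andP; split; lra.
  apply: geometric_growth; first by case/andP: w01 => *; lra.
  near=> n.
  have hn : w / ((1 - w) / 2) <= n%:R by near: n; exact: nbhs_infty_ger.
  have : w <= n%:R * ((1 - w) / 2) by rewrite -ler_pdivrMr// divr_gt0.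
  move=> h; rewrite exprS mulrA [leRHS]mulrA ler_wpM2r ?exprn_ge0//.
  by rewrite -natr1; lra.
have [t0 tlt1] := andP t1.
apply: (@cvg_geometric_bound _ _ t (C' * (C ^+ 2 / (1 - w)))) => [|N].
  by rewrite ger0_norm.
rewrite (ger0_norm t0) mulrA [_ * C']mulrC.
apply: (@le_trans _ _ (N%:R * w ^+ N * (C ^+ 2 / (1 - w)))); last first.
  by rewrite ler_wpM2r// divr_ge0 ?exprn_ge0// ltW.
rewrite (le_trans (ler_norm_sum _ _ _))//.
apply: (@le_trans _ _ (\sum_(0 <= k < N) w ^+ N * (C ^+ 2 / (1 - w)))); last first.
  by rewrite sumr_const_nat subn0 -[leLHS]mulr_natl mulrA.
rewrite big_seq [leRHS]big_seq; apply: ler_sum => k; rewrite mem_index_iota /= => kN.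
rewrite normrM; apply: (@le_trans _ _ ((C * w ^+ k) * (C * w ^+ (N - k) / (1 - w)))).
  by rewrite ler_pM// geometric_partial_le.
rewrite -{2}(subnKC (ltnW kN)) exprD expr2.
by rewrite le_eqVlt; apply/orP; left; apply/eqP; ring.
Unshelve. all: end_near. Qed.

End Triangle_sums.

Section QBinomial_series.
Context {R : realType} (q : R).
Hypothesis hq : -1 < q < 1.
Implicit Types (r : R) (n j N : nat).

(** The q-binomial coefficient of [n + j] over [j]. *)
Let qbin n j : R := qfact q (n + j) / (qfact q n * qfact q j).

Lemma qbin_bound n : exists2 C, 0 <= C & forall j, `|qbin n j| <= C.
Proof.
elim: n => [|n [C C0 hC]].
  by exists 1 => // j; rewrite /qbin add0n qfact0 mul1r mulfV ?qfact_neq0// normr1.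
have qn m : `|qnat q m| <= 2 / (1 - q).
  have q1 : 0 < 1 - q by case/andP: hq => _; rewrite subr_gt0.
  rewrite (qnat_def hq) normrM normfV (gtr0_norm q1) ler_pM2r ?invr_gt0//.
  rewrite (le_trans (ler_normB _ _))// normr1 -[2]/(1 + 1) lerD2l.
  exact: normqX_le.
exists (C * (2 / (1 - q) / qnat q n.+1)).
  rewrite mulr_ge0// divr_ge0 ?(ltW (qnat_gt0 hq n))//.
  by rewrite divr_ge0// subr_ge0; case/andP: hq => _ /ltW.
move=> j; have -> : qbin n.+1 j = qbin n j * (qnat q (n + j).+1 / qnat q n.+1).
  by rewrite /qbin addSn !qfactS; field; rewrite !qfact_neq0// qnat_neq0.
rewrite normrM ler_pM// normrM normfV (gtr0_norm (qnat_gt0 hq n)).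
by rewrite ler_pM2r ?invr_gt0 ?qnat_gt0.
Qed.

Lemma qbin_pascal n j :
  qbin n.+1 j.+1 = qbin n j.+1 + q ^+ n.+1 * qbin n.+1 j.
Proof.
rewrite /qbin !addSn !addnS !qfactS.
have := qnat_neq0 hq n; have := qnat_neq0 hq j.
rewrite !(qnat_def hq) => h1 h2.
have h1' : 1 - q ^+ j.+1 != 0 by apply: contraNneq h1 => ->; rewrite mul0r.
have h2' : 1 - q ^+ n.+1 != 0 by apply: contraNneq h2 => ->; rewrite mul0r.
move: h1' h2'; rewrite !exprS exprD => h1' h2'.
by field; rewrite !(qfact_neq0 hq) (subr1q_neq0 hq) h1' h2'.
Qed.

(** The q-binomial theorem for [1 / (r)_(n+1)], by induction on [n]: Pascal's rule
    gives [(1 - r * q ^+ n.+1)] times the sum for [n.+1] as the sum for [n]. *)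
Lemma qbin_series_cvg r n : `|r| < 1 ->
  series (fun j => r ^+ j * qbin n j) @ \oo --> (qpoch q r n.+1)^-1.
Proof.
move=> r1; have r01 : 0 <= `|r| < 1 by rewrite normr_ge0.
have bd m : exists C, forall j, `|r ^+ j * qbin m j| <= C * `|r| ^+ j.
  have [C C0 hC] := qbin_bound m; exists C => j.
  by rewrite normrM normrX mulrC ler_wpM2r ?exprn_ge0.
elim: n => [|n IH].
  rewrite (_ : (fun j => _) = geometric 1 r); last first.
    apply/funext => j; rewrite /geometric /= mul1r /qbin add0n qfact0 mul1r.
    by rewrite mulfV ?qfact_neq0// mulr1.
  rewrite qpochS qpoch0 expr0 mulr1 mul1r -div1r.
  exact: cvg_geometric_series.
have d0 : 1 - r * q ^+ n.+1 != 0 by rewrite gt_eqF// subr1_Xq_gt0.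
have part N : series (fun j => r ^+ j * qbin n.+1 j) N.+1 =
    (series (fun j => r ^+ j * qbin n j) N.+1 -
     r * q ^+ n.+1 * (r ^+ N * qbin n.+1 N)) / (1 - r * q ^+ n.+1).
  apply: (canRL (mulfK d0)).
  elim: N => [|N IHN].
    rewrite /series /= !big_nat1 /qbin !addn0 qfact0 !mulr1 !mulfV ?qfact_neq0//.
    by ring.
  rewrite seriesSr mulrDl IHN [in RHS]seriesSr qbin_pascal !exprS.
  by ring.
have [C hC] := bd n.+1.
rewrite -cvg_shiftS /=.
under eq_fun do rewrite part.
rewrite qpochS invfM; apply: cvgM; last exact: cvg_cst.
rewrite -[X in _ --> X]subr0; apply: cvgB; first by rewrite cvg_shiftS.
rewrite -(mulr0 (r * q ^+ n.+1)); apply: cvgMr.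
apply: (@cvg_geometric_bound _ _ r C) => // N.
by rewrite [leRHS]mulrC.
Qed.

End QBinomial_series.

(** * The densities as Mehler series *)

Lemma cvgn_bound {R : realType} (u : nat -> R) : cvgn u ->
  exists2 M, 0 <= M & forall n, `|u n| <= M.
Proof.
move=> /cvg_seq_bounded[M [_ hM]]; exists (Num.max M 0 + 1).
  by rewrite addr_ge0// le_max lexx orbT.
by move=> n; apply: hM => //; rewrite ltr_pwDr// le_max lexx.
Qed.

Section Products.
Context {R : realType} (q : R).
Hypothesis hq : -1 < q < 1.
Implicit Types (x y r : R) (n N : nat).

Lemma lq_le x r : supp q x -> lq q x r <= (1 + `|r|) ^+ 2.
Proof.
move=> /(suppP hq) hx; rewrite /lq.
have kx : 0 <= (1 - q) * x ^+ 2.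
  by rewrite mulr_ge0 ?sqr_ge0// subr_ge0; case/andP: hq => _ /ltW.
rewrite mulrAC; move: ((1 - q) * x ^+ 2) kx hx => t t0 t4.
have [r0|r0] := leP 0 r.
  by have := mulr_ge0 r0 t0; rewrite (ger0_norm r0) !expr2; lra.
have : (- r) * t <= (- r) * 4 by rewrite ler_wpM2l// oppr_ge0 ltW.
by rewrite (ltr0_norm r0) !expr2; lra.
Qed.

Lemma lq_prod_bound : exists2 B, 0 <= B & forall x N, supp q x ->
  0 <= \prod_(1 <= i < N) lq q x (q ^+ i) <= B.
Proof.
have aq1 : `|(- `|q|)| < 1 by rewrite normrN normr_id normq_lt1.
have haq : -1 < `|q| < 1.
  by rewrite (normq_lt1 hq) (lt_le_trans _ (normr_ge0 q))// ltrN10.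
have [M M0 hM] := cvgn_bound (cvgP _ (qpoch_cvg haq aq1).1).
exists (M ^+ 2); first exact: sqr_ge0.
move=> x N hx; apply/andP; split.
  by apply: prodr_ge0 => i _; apply: lq_ge0 => //; exact: normqX_le.
apply: (@le_trans _ _ (\prod_(1 <= i < N) (1 + `|q| ^+ i) ^+ 2)).
  apply: ler_prod => i _; rewrite lq_ge0 ?normqX_le//=.
  by rewrite -normrX; exact: lq_le.
rewrite prodrXl.
have h0 : 0 <= \prod_(1 <= i < N) (1 + `|q| ^+ i).
  by apply: prodr_ge0 => i _; rewrite addr_ge0// exprn_ge0.
rewrite lerXn2r ?nnegrE//.
rewrite (le_trans _ (hM N.-1))// (le_trans _ (ler_norm _))//.
rewrite /qpoch -{1}(add0n 1%N) big_addn subn1 le_eqVlt; apply/orP; left; apply/eqP.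
by apply: eq_bigr => i _; rewrite mulNr opprK addn1 exprS.
Qed.

(** On the diagonal, [omegaq q x x] is [lq q x] times the square of a factor of
    the q-shifted factorial ([omegaqxx]), so that this is a special case of
    [mehler_cvg]. *)
Lemma lq_prod_cvg x r : `|r| < 1 -> supp q x ->
  \prod_(0 <= i < N) lq q x (r * q ^+ i) @[N --> \oo] -->
  qpoch_oo q (r ^+ 2) / (mehler q r x x * qpoch_oo q r ^+ 2).
Proof.
move=> r1 hx; have [cr r0] := qpoch_cvg hq r1.
have [K0 cK] := mehler_cvg hq r1 hx hx.
have -> : (fun N => \prod_(0 <= i < N) lq q x (r * q ^+ i)) =
    fun N => (\prod_(0 <= i < N) omegaq q x x (r * q ^+ i)) * (qpoch q r N ^- 2).
  apply/funext => N; apply: (canRL (mulfK _)).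
    by rewrite expf_neq0// gt_eqF// qpoch_gt0.
  rewrite /qpoch -prodrXl -big_split /=; apply: eq_bigr => i _.
  by rewrite omegaqxx mulrC.
rewrite invfM mulrA; apply: cvgM => //.
apply: cvgV; first by rewrite expf_neq0// gt_eqF.
by rewrite expr2; under eq_fun do rewrite expr2; exact: cvgM.
Qed.

Lemma fN_prod_cvg x : supp q x ->
  cvgn (fun N => \prod_(1 <= i < N) lq q x (q ^+ i)).
Proof.
move=> hx; have h := lq_prod_cvg (normq_lt1 hq) hx.
apply/cvg_ex; eexists; rewrite -cvg_shiftS /=; apply: cvg_trans h.
apply: near_eq_cvg; apply: nearW => N.
rewrite -[in RHS](add0n 1%N) big_addn subn1; apply: eq_bigr => i _.
by rewrite addn1 exprS.
Qed.

Lemma qpoch_ooS r : `|r| < 1 -> qpoch_oo q r = (1 - r) * qpoch_oo q (r * q).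
Proof.
move=> r1.
have rq1 : `|r * q| < 1 by rewrite normrM mulr_ilt1// normq_lt1.
have [cr _] := qpoch_cvg hq r1; have [cq _] := qpoch_cvg hq rq1.
have L1 : qpoch q r N.+1 @[N --> \oo] --> qpoch_oo q r by rewrite cvg_shiftS.
have L2 : qpoch q r N.+1 @[N --> \oo] --> (1 - r) * qpoch_oo q (r * q).
  by under eq_fun do rewrite qpoch_recl; exact: cvgMr.
exact: cvgn_unique L1 L2.
Qed.

Lemma fRE x r : `|r| < 1 -> supp q x ->
  fR q r x = (1 - r) * fN q x * mehler q r x x.
Proof.
move=> r1 hx; rewrite /fR (cvg_lim _ (lq_prod_cvg r1 hx))//.
have rq1 : `|r * q| < 1 by rewrite normrM mulr_ilt1// normq_lt1.
have r21 : `|r ^+ 2| < 1 by rewrite normrX exprn_ilt1.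
have [_ r0] := qpoch_cvg hq r1; have [_ rq0] := qpoch_cvg hq rq1.
have [_ r20] := qpoch_cvg hq r21; have [K0 _] := mehler_cvg hq r1 hx hx.
have rr : 1 - r != 0 by rewrite subr_eq0 gt_eqF// (le_lt_trans (ler_norm _)).
rewrite (qpoch_ooS r1) in r0 *.
by field; rewrite K0 rr !gt_eqF.
Qed.

Lemma fYZE x y r12 r13 r23 : `|r23| < 1 -> `|r12 * r13| < 1 ->
  supp q x -> supp q y ->
  fYZ q r12 r13 r23 x y = (1 - r12 * r13 * r23) * fN q x * fN q y *
    (mehler q r23 x y * mehler q (r12 * r13) x y).
Proof.
move=> a1 b1 hx hy; rewrite /fYZ.
have [Ka ca] := mehler_cvg hq a1 hx hy.
have [Kb cb] := mehler_cvg hq b1 hx hy.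
have a21 : `|r23 ^+ 2| < 1 by rewrite normrX exprn_ilt1.
have b21 : `|(r12 * r13) ^+ 2| < 1 by rewrite normrX exprn_ilt1.
have [_ a20] := qpoch_cvg hq a21; have [_ b20] := qpoch_cvg hq b21.
congr (_ * _).
have -> : limn (fun N : nat => \prod_(0 <= i < N)
     (omegaq q x y (r23 * q ^+ i) * omegaq q x y (r12 * r13 * q ^+ i))) =
    (qpoch_oo q (r23 ^+ 2) / mehler q r23 x y *
    (qpoch_oo q ((r12 * r13) ^+ 2) / mehler q (r12 * r13) x y)).
  apply/cvg_lim => //; under eq_fun do rewrite big_split /=.
  exact: cvgM.
by rewrite -exprMn; field; rewrite Ka Kb !gt_eqF.
Qed.

Let c0 := qpoch_oo q q * Num.sqrt (1 - q) / (2 * pi).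

(** The density [fN] with its product truncated and without its constant; [fN_trunc q 1]
    is the semicircle. *)
Definition fN_trunc N x := Num.sqrt (4 - (1 - q) * x ^+ 2) *
  \prod_(1 <= i < N) lq q x (q ^+ i).

Lemma fN_trunc_cvg x : supp q x -> c0 * fN_trunc N x @[N --> \oo] --> fN q x.
Proof.
move=> hx; have -> : fN q x = c0 * (Num.sqrt (4 - (1 - q) * x ^+ 2) *
  limn (fun N : nat => \prod_(1 <= i < N) lq q x (q ^+ i))).
  by rewrite /fN /c0; ring.
by apply: cvgMr; apply: cvgMr; exact: fN_prod_cvg.
Qed.

Lemma fN_const_ge0 : 0 <= c0.
Proof.
have [_ q0] := qpoch_cvg hq (normq_lt1 hq).
by rewrite divr_ge0 ?mulr_ge0 ?sqrtr_ge0 ?(ltW q0) ?pi_ge0.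
Qed.

Lemma fN_trunc_bound : exists2 B, 0 <= B & forall x N, supp q x -> 0 <= fN_trunc N x <= B.
Proof.
have [B B0 hB] := lq_prod_bound.
exists (2 * B); first by rewrite mulr_ge0.
move=> x N hx; have /andP[p0 pB] := hB x N hx.
rewrite mulr_ge0 ?sqrtr_ge0//= ler_pM ?sqrtr_ge0//.
have -> : (2 : R) = Num.sqrt (2 ^+ 2) by rewrite sqrtr_sqr ger0_norm.
have -> : (2 ^+ 2 : R) = 4 by rewrite expr2; ring.
rewrite ler_sqrt// lerBlDr lerDl mulr_ge0 ?sqr_ge0// subr_ge0.
by case/andP: hq => _ /ltW.
Qed.

Lemma fN_bound : exists2 B, 0 <= B & forall x, supp q x -> 0 <= fN q x <= B.
Proof.
have [B B0 hB] := fN_trunc_bound.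
exists (c0 * B); first by rewrite mulr_ge0 ?fN_const_ge0.
move=> x hx; have cv := fN_trunc_cvg hx.
rewrite -(cvg_lim _ cv)//; apply/andP; split.
  apply: limr_ge; first exact: cvgP cv.
  by apply: nearW => N; rewrite mulr_ge0 ?fN_const_ge0//; case/andP: (hB x N hx).
apply: limr_le; first exact: cvgP cv.
by apply: nearW => N; rewrite ler_wpM2l ?fN_const_ge0//; case/andP: (hB x N hx).
Qed.

End Products.

(** * Expectations under a density *)

Section Density.
Context {d} {T : measurableType d} {R : realType} (P : probability T R).
Context {d'} {U : measurableType d'} (mu : {measure set U -> \bar R}).
Variables (D : set U) (f : U -> R) (X : T -> U).
Hypothesis mD : measurable D.
Hypothesis mX : measurable_fun setT X.
Hypothesis mf : measurable_fun D f.
Hypothesis f0 : forall u, D u -> 0 <= f u.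
Hypothesis dX : has_density P mu D f X.

Let indic (E : set U) : measurable E ->
  (\int[P]_w (\1_E (X w))%:E = \int[mu]_(u in D) (\1_E u * f u)%:E)%E.
Proof.
move=> mE.
transitivity (P (X @^-1` E)).
  rewrite -[X in P X]setIT -integral_indic//.
  by rewrite -[X in measurable X]setTI; exact: mX.
rewrite dX// setIC integral_mkcondr; apply: eq_integral => u _.
rewrite patchE indicE; case: ifPn => uE; first by rewrite mul1r.
by rewrite mul0r.
Qed.

Import HBNNSimple.

Let nnsfun_case (h : {nnsfun U >-> R}) :
  (\int[P]_w (h (X w))%:E = \int[mu]_(u in D) (h u * f u)%:E)%E.
Proof.
under [LHS]eq_integral do rewrite fimfunE -fsumEFin//.
rewrite [LHS]ge0_integral_fsum//; last 2 first.
  - move=> r; apply/measurable_EFinP; apply: measurable_funM => //.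
    by apply: measurableT_comp.
  - by move=> n x _; rewrite EFinM nnfun_muleindic_ge0.
under [RHS]eq_integral.
  move=> x xD; rewrite EFinM fimfunE -fsumEFin// ge0_mule_fsuml; last first.
    by move=> r; rewrite EFinM nnfun_muleindic_ge0.
  over.
rewrite [RHS]ge0_integral_fsum//; last 2 first.
  - move=> r; apply/measurable_EFinP; apply: measurable_funM => //.
    apply: measurable_funM => //.
  - move=> n x xD; rewrite EFinM mule_ge0//; last by rewrite lee_fin f0.
    by rewrite nnfun_muleindic_ge0.
apply: eq_fsbigr => r _.
have mr : measurable (h @^-1` [set r]) by [].
have [r0|r0] := leP 0 r; last first.
  have E0 : h @^-1` [set r] = set0.
    by rewrite -subset0 => x /= hx; have : 0 <= h x by []; rewrite hx leNgt r0.
  rewrite E0; under eq_integral do rewrite indic0 mulr0.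
  under [RHS]eq_integral do rewrite indic0 mulr0 mul0e.
  by rewrite !integral0.
under eq_integral do rewrite EFinM.
rewrite ge0_integralZl//; last first.
  by apply/measurable_EFinP; apply: measurableT_comp.
rewrite indic//.
under [RHS]eq_integral do rewrite EFinM -muleA.
rewrite [RHS]ge0_integralZl//.
  by apply: emeasurable_funM; apply/measurable_EFinP => //.
by move=> x xD; rewrite mule_ge0// lee_fin ?f0.
Qed.

Let ge0_case (g : U -> R) : measurable_fun setT g -> (forall u, 0 <= g u) ->
  (\int[P]_w (g (X w))%:E = \int[mu]_(u in D) (g u * f u)%:E)%E.
Proof.
move=> mg g0.
have mG : measurable_fun setT (EFin \o g) by exact/measurable_EFinP.
pose h := nnsfun_approx measurableT mG.
have hg u : (h n u)%:E @[n --> \oo] --> (g u)%:E.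
  by apply: (cvg_nnsfun_approx measurableT mG) => //= x _; rewrite lee_fin.
have hnd u : {homo (fun n => h n u) : n m / (n <= m)%N >-> n <= m}.
  by move=> n m nm; exact/lefP/nd_nnsfun_approx.
transitivity (limn (fun n => \int[P]_w (h n (X w))%:E)%E).
  rewrite -monotone_convergence//=.
  - by apply: eq_integral => w _; apply/esym/cvg_lim => //; exact: hg.
  - by move=> n; apply/measurable_EFinP; exact: measurableT_comp.
  - by move=> n w _; rewrite lee_fin.
  - by move=> w _ n m nm; rewrite lee_fin hnd.
under eq_fun do rewrite nnsfun_case.
rewrite -monotone_convergence//=.
- apply: eq_integral => u; rewrite inE => uD; apply/cvg_lim => //.
  rewrite EFinM; under eq_fun do rewrite EFinM.
  by apply: cvgeZr => //; exact: hg.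
- move=> n; apply/measurable_EFinP; apply: measurable_funM => //.
  exact: measurable_funTS.
- by move=> n u uD; rewrite lee_fin mulr_ge0// f0.
- by move=> u uD n m nm; rewrite lee_fin ler_wpM2r ?f0// hnd.
Qed.

(** The law of [X] and the measure with density [f] on [D] agree on measurable
    sets; the equality extends to simple functions by linearity, to nonnegative
    functions by monotone convergence, and to all measurable functions since the
    positive and negative parts commute with the product by [f >= 0]. *)
Lemma integral_has_density (g : U -> R) : measurable_fun setT g ->
  (\int[P]_w (g (X w))%:E = \int[mu]_(u in D) (g u * f u)%:E)%E.
Proof.
move=> mg; rewrite [LHS]integralE [RHS]integralE; congr (_ - _)%E.
- transitivity (\int[P]_w (g^\+ (X w))%:E)%E.
    by apply: eq_integral => w _; rewrite funeposE /funrpos EFin_max.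
  rewrite ge0_case//; last exact: measurable_funrpos.
  apply: eq_integral => u; rewrite inE => uD.
  by rewrite funeposE /funrpos -EFin_max maxr_pMl ?f0// mul0r.
- transitivity (\int[P]_w (g^\- (X w))%:E)%E.
    by apply: eq_integral => w _; rewrite funenegE /funrneg EFin_max EFinN.
  rewrite ge0_case//; last exact: measurable_funrneg.
  apply: eq_integral => u; rewrite inE => uD.
  by rewrite funenegE /funrneg -EFinN -EFin_max maxr_pMl ?f0// mul0r mulNr.
Qed.

End Density.

(** * Integrals of bounded functions *)

Section Bounded.
Context {d} {T : measurableType d} {R : realType}.
Variables (mu : {measure set T -> \bar R}) (D : set T).
Hypothesis mD : measurable D.
Hypothesis muD : (mu D < +oo)%E.
Implicit Types (f g : T -> R).

Definition bounded_mfun f := measurable_fun D f /\ exists M, forall x, D x -> `|f x| <= M.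

Lemma bounded_mfun_integrable f : bounded_mfun f -> mu.-integrable D (EFin \o f).
Proof.
move=> [mf [M hM]]; apply: measurable_bounded_integrable => //.
exists M; split; first exact: num_real.
by move=> y My x Dx /=; rewrite (le_trans (hM x Dx))// ltW.
Qed.

Lemma bounded_mfun_cst (c : R) : bounded_mfun (fun=> c).
Proof. by split; [exact: measurable_cst|exists `|c|]. Qed.

Lemma bounded_mfunM f g : bounded_mfun f -> bounded_mfun g ->
  bounded_mfun (fun x => f x * g x).
Proof.
move=> [mf [M hM]] [mg [N hN]]; split; first exact: measurable_funM.
by exists (M * N) => x Dx; rewrite normrM ler_pM ?hM ?hN.
Qed.

Lemma bounded_mfunD f g : bounded_mfun f -> bounded_mfun g ->
  bounded_mfun (fun x => f x + g x).
Proof.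
move=> [mf [M hM]] [mg [N hN]]; split; first exact: measurable_funD.
by exists (M + N) => x Dx; rewrite (le_trans (ler_normD _ _))// lerD ?hM ?hN.
Qed.

Lemma bounded_mfun_sum (F : nat -> T -> R) n : (forall k, bounded_mfun (F k)) ->
  bounded_mfun (fun x => \sum_(0 <= k < n) F k x).
Proof.
move=> hF; elim: n => [|n IH].
  by under eq_fun do rewrite big_geq//; exact: bounded_mfun_cst.
by under eq_fun do rewrite big_nat_recr//=; exact: bounded_mfunD.
Qed.

Lemma Rintegral_bounded_sum (F : nat -> T -> R) n : (forall k, bounded_mfun (F k)) ->
  \int[mu]_(x in D) (\sum_(0 <= k < n) F k x) =
  \sum_(0 <= k < n) \int[mu]_(x in D) F k x.
Proof.
move=> hF; elim: n => [|n IH].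
  under eq_Rintegral do rewrite big_geq//.
  by rewrite big_geq// /Rintegral integral0.
under eq_Rintegral do rewrite big_nat_recr//=.
rewrite big_nat_recr//= -IH RintegralD//; apply: bounded_mfun_integrable => //.
exact: bounded_mfun_sum.
Qed.

Lemma Rintegral_boundedZ a f : bounded_mfun f ->
  \int[mu]_(x in D) (a * f x) = a * \int[mu]_(x in D) f x.
Proof. by move=> hf; rewrite RintegralZl//; exact: bounded_mfun_integrable. Qed.

Lemma Rintegral_boundedD f g : bounded_mfun f -> bounded_mfun g ->
  \int[mu]_(x in D) (f x + g x) =
  \int[mu]_(x in D) f x + \int[mu]_(x in D) g x.
Proof. by move=> hf hg; rewrite RintegralD//; exact: bounded_mfun_integrable. Qed.

Lemma EFin_Rintegral f : bounded_mfun f ->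
  (\int[mu]_(x in D) f x)%:E = (\int[mu]_(x in D) (f x)%:E)%E.
Proof. by move=> /bounded_mfun_integrable hf; rewrite fineK// integrable_fin_num. Qed.

Lemma bounded_mfun_limit (F : nat -> T -> R) f M :
  (forall n, measurable_fun D (F n)) ->
  (forall n x, D x -> `|F n x| <= M) ->
  (forall x, D x -> F n x @[n --> \oo] --> f x) -> bounded_mfun f.
Proof.
move=> mF hM cF; split; first exact: measurable_fun_cvg cF.
exists M => x Dx; have c := cF x Dx.
have c' : `|F n x| @[n --> \oo] --> `|f x| by apply: cvg_norm.
rewrite -(cvg_lim _ c')//; apply: limr_le; first exact: cvgP c'.
by apply: nearW => n; exact: hM.
Qed.

Lemma bounded_convergence (F : nat -> T -> R) f M :
  (forall n, measurable_fun D (F n)) ->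
  (forall n x, D x -> `|F n x| <= M) ->
  (forall x, D x -> F n x @[n --> \oo] --> f x) ->
  \int[mu]_(x in D) F n x @[n --> \oo] --> \int[mu]_(x in D) f x.
Proof.
move=> mF hM cF.
have bf := bounded_mfun_limit mF hM cF.
apply: fine_cvg; rewrite EFin_Rintegral//.
apply: (@dominated_cvg _ _ _ mu D mD (fun n x => (F n x)%:E) (fun x => (f x)%:E)
  (fun=> M%:E)).
- by move=> n; apply/measurable_EFinP.
- by move=> x Dx; apply: cvg_EFin; [exact: nearW|exact: cF].
- by [].
- exact: (bounded_mfun_integrable (bounded_mfun_cst M)).
- by move=> n x Dx; rewrite lee_fin hM.
Qed.

End Bounded.

(** * Orthogonality of the q-Hermite polynomials *)

Section Weights.
Context {R : realType} (q : R).
Hypothesis hq : -1 < q < 1.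
Implicit Types (w : R -> R) (p : {poly R}).
Local Notation H := (qhermite q).
Local Notation mu := (@lebesgue_measure R).
Local Notation S := (supp q).
Local Notation bmS := (@bounded_mfun _ (measurableTypeR R) R (supp q)).

Lemma measurable_supp : measurable (S : set (measurableTypeR R)).
Proof. exact: measurable_itv. Qed.

Lemma supp_lty : (mu S < +oo)%E.
Proof.
rewrite /supp lebesgue_measure_itv /=.
by case: ifP => _; rewrite ?ltry// -EFinD ltry.
Qed.

Lemma bounded_mfun_horner p : bmS (horner p).
Proof.
elim/poly_ind: p => [|p c IH].
  rewrite (_ : horner 0 = fun=> 0); first exact: bounded_mfun_cst.
  by apply/funext => x; rewrite horner0.
rewrite (_ : horner _ = fun x => p.[x] * x + c); last first.
  by apply/funext => x; rewrite !hornerE.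
apply: bounded_mfunD; last exact: bounded_mfun_cst.
apply: bounded_mfunM => //; split; first exact: measurable_id.
exists (2 / Num.sqrt (1 - q)) => x.
by rewrite /supp set_itvcc /= ler_norml.
Qed.

(** The linear functional is packed as a morphism so that the algebraic results
    on functionals apply to integrals. *)
Lemma weight_functional w : bmS w ->
  exists L : {scalar {poly R}}, forall p, L p = \int[mu]_(x in S) (p.[x] * w x).
Proof.
move=> hw.
have bw p : bmS (fun x => p.[x] * w x).
  by apply: bounded_mfunM => //; exact: bounded_mfun_horner.
pose L p := \int[mu]_(x in S) (p.[x] * w x).
have hL : scalar L.
  move=> a p p'; have mS := measurable_supp; have fS := supp_lty.
  have ba : bmS (fun x => a * (p.[x] * w x)).
    by apply: bounded_mfunM => //; exact: bounded_mfun_cst.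
  rewrite /L -(Rintegral_boundedZ mS fS a (bw p)) -(Rintegral_boundedD mS fS ba (bw p')).
  by apply: eq_Rintegral => x _; rewrite hornerD hornerZ mulrDl mulrA.
by exists (HB.pack L (GRing.isLinear.Build R {poly R} R _ L hL) : {scalar {poly R}}).
Qed.

Lemma bounded_mfun_fN_trunc N : bmS (fN_trunc q N).
Proof.
have [B B0 hB] := fN_trunc_bound hq; split; last first.
  by exists B => x hx; case/andP: (hB x N hx) => w0 wB; rewrite ger0_norm.
apply: measurable_funTS; apply: measurable_funM.
  apply: measurableT_comp => //.
    exact: continuous_measurable_fun (@sqrt_continuous R).
  by apply: measurable_funB => //; apply: measurable_funM => //; exact: measurable_funX.
apply: measurable_prod => i _ /=.
apply: measurable_funB => //; apply: measurable_funM => //; exact: measurable_funX.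
Qed.

(** The integrand is the derivative of (4 - (1 - q) x^2)^(3/2) p(x), which
    vanishes at both ends of the support. *)
Lemma semicircle_FTC p :
  \int[mu]_(x in S) (((4%:P - (1 - q)%:P * 'X^2) * p^`()
      - 3%:P * (1 - q)%:P * 'X * p).[x] * fN_trunc q 1 x) = 0.
Proof.
have k0 : 0 < 1 - q by case/andP: hq => _; rewrite subr_gt0.
have s0 : 0 < Num.sqrt (1 - q) by rewrite sqrtr_gt0.
set b := 2 / Num.sqrt (1 - q); have b0 : 0 < b by rewrite divr_gt0.
pose G : {poly R} := 4%:P - (1 - q)%:P * 'X^2.
have GE x : G.[x] = 4 - (1 - q) * x ^+ 2 by rewrite /G !hornerE.
have G'E : G^`() = - ((2 * (1 - q))%:P * 'X).
  rewrite /G derivB derivC sub0r derivM derivC mul0r add0r derivXn /= expr1.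
  by rewrite mulrnAr -mulrnAl -polyCMn mulr_natl.
have kb : (1 - q) * b ^+ 2 = 4.
  rewrite /b exprMn exprVn sqr_sqrtr ?(ltW k0)// mulrCA divff ?gt_eqF// mulr1.
  by rewrite expr2; ring.
have w1 : fN_trunc q 1 = Num.sqrt \o horner G.
  by apply/funext => x; rewrite /fN_trunc big_geq// mulr1 /= GE.
(* F is G^(3/2) p with G = 4 - (1 - q) x^2. *)
pose F : R -> R := (horner G * (Num.sqrt \o horner G)) * horner p.
have cF : continuous F.
  move=> x; apply: cvgM; last exact: continuous_horner.
  apply: cvgM; first exact: continuous_horner.
  apply: continuous_comp; first exact: continuous_horner.
  exact: sqrt_continuous.
have G0 x : x \in `]- b, b[ -> 0 < G.[x].
  rewrite in_itv /= -ltr_norml => xb; rewrite GE subr_gt0 -kb ltr_pM2l//.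
  by rewrite -(real_normK (num_real x)) ltrXn2r// nnegrE ltW.
have dF x : x \in `]- b, b[ -> is_derive x 1 F
    ((G.[x] * ((2 * Num.sqrt G.[x])^-1 * G^`().[x]) + Num.sqrt G.[x] * G^`().[x])
      * p.[x] + G.[x] * Num.sqrt G.[x] * p^`().[x]).
  move=> xb.
  have h1 := is_derive_poly G x.
  have h2 := is_derive1_sqrt (G0 x xb).
  have h3 := is_derive1_comp h2 h1.
  have h4 := is_deriveM h1 h3.
  have h5 := is_deriveM h4 (is_derive_poly p x).
  apply: is_derive_eq h5 _.
  by rewrite /GRing.scale /= [LHS]addrC; congr (_ + _); exact: mulrC.
rewrite /Rintegral (_ : (\int[mu]_(x in S) _ = (F b)%:E - (F (- b))%:E)%E).
  have Gb : G.[b] = 0 by rewrite GE kb subrr.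
  have GNb : G.[- b] = 0 by rewrite GE sqrrN kb subrr.
  by rewrite /F !fctE /= Gb GNb !mul0r subrr.
rewrite /supp -/b.
apply: continuous_FTC2.
- by rewrite (lt_trans _ b0)// oppr_lt0.
- apply: continuous_subspaceT => x; apply: cvgM; first exact: continuous_horner.
  rewrite w1; apply: continuous_comp; first exact: continuous_horner.
  exact: sqrt_continuous.
- split => [x xb||]; last 2 first.
  + by apply: cvg_at_right_filter; exact: cF.
  + by apply: cvg_at_left_filter; exact: cF.
  by have [] := dF x xb.
- move=> x xb; rewrite derive1E; have [_ ->] := dF x xb.
  have /sqr_sqrtr sG : 0 <= G.[x] by rewrite ltW// G0.
  have sG0 : Num.sqrt G.[x] != 0 by rewrite gt_eqF// sqrtr_gt0 G0.
  rewrite w1 /= G'E -/G.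
  have -> : (G * p^`() - 3%:P * (1 - q)%:P * 'X * p).[x] =
      Num.sqrt G.[x] ^+ 2 * p^`().[x] - 3 * (1 - q) * x * p.[x].
    by rewrite sG hornerD hornerN !hornerM !hornerC hornerX.
  rewrite hornerN hornerM hornerC hornerX.
  move: sG sG0; move: (Num.sqrt G.[x]) => s sG sG0; rewrite -sG.
  by field.
Qed.

End Weights.

Section Orthogonality.
Context {R : realType} (q : R).
Hypothesis hq : -1 < q < 1.
Implicit Types (w : R -> R) (p : {poly R}).
Local Notation H := (qhermite q).
Local Notation mu := (@lebesgue_measure R).
Local Notation S := (supp q).
Local Notation bmS := (@bounded_mfun _ (measurableTypeR R) R (supp q)).

(** The first [N] factors of the product in [fN] are those by which [fN] and
    [fR q (q ^+ N.+1)] differ, up to a constant. *)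
Lemma fN_trunc_rogers_moments N (L : {scalar {poly R}}) :
  (forall p, L p = \int[mu]_(x in S) (p.[x] * fN_trunc q N.+1 x)) ->
  has_rogers_moments q L (q ^+ N.+1).
Proof.
elim: N L => [|N IH] L hL.
  by apply: semicircle_rogers_moments => // p; rewrite hL semicircle_FTC.
have [L0 hL0] := weight_functional (bounded_mfun_fN_trunc hq N.+1).
rewrite exprSr; apply: (rogers_moments_mul_lq hq _ _ (IH L0 hL0)).
  by rewrite normrX exprn_ilt1// normq_lt1.
move=> p; rewrite hL hL0; apply: eq_Rintegral => x _.
rewrite /fN_trunc big_nat_recr//= /lq.
rewrite !(hornerD, hornerN, hornerM, hornerC, hornerX).
by ring.
Qed.

Lemma bounded_mfun_fN : bmS (fN q).
Proof.
have [B B0 hB] := fN_bound hq; split; last first.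
  by exists B => x hx; case/andP: (hB x hx) => f0 fB; rewrite ger0_norm.
apply: (measurable_fun_cvg (fun N => _) (fun x hx => fN_trunc_cvg hq hx)) => N.
by apply: measurable_funM => //; have [] := bounded_mfun_fN_trunc hq N.
Qed.

(** The moment is [b ^+ n] times a factor that stays bounded as [b] tends to 0. *)
Lemma rogers_moment_cvg0 n : (0 < n)%N ->
  rogers_moment q (q ^+ N.+1) n @[N --> \oo] --> 0.
Proof.
move=> n0.
have q0 : q ^+ N.+1 @[N --> \oo] --> 0.
  rewrite (_ : (fun N => _) = fun N => [sequence q ^+ N]_N N.+1)//.
  by rewrite cvg_shiftS; apply: cvg_expr; exact: normq_lt1.
have qp m : qpoch q (q ^+ N.+1 * q) m @[N --> \oo] --> (1 : R).
  elim: m => [|m IH]; first by under eq_fun do rewrite qpoch0; exact: cvg_cst.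
  have : qpoch q (q ^+ N.+1 * q) m * (1 - q ^+ N.+1 * (q * q ^+ m))
      @[N --> \oo] --> 1 * (1 - 0 * (q * q ^+ m)).
    by apply: cvgM => //; apply: cvgB; [exact: cvg_cst|exact: cvgMl].
  rewrite mul0r subr0 mulr1 => h.
  by under eq_fun do rewrite qpochS -mulrA.
have qn : (q ^+ N.+1) ^+ n @[N --> \oo] --> 0.
  have -> : 0 = (0 : R) ^+ n by rewrite expr0n gtn_eqF.
  exact: (cvg_comp _ _ q0 (@exprn_continuous R n 0)).
rewrite /rogers_moment -(mul0r ((qfact q n * 1)^-1)) -(mul0r (qfact q (2 * n))).
apply: cvgM; first exact: cvgMl.
by apply: cvgV; [rewrite mulr1 qfact_neq0|exact: cvgMr].
Qed.

(** As the truncation order grows, [fN_trunc] tends to a multiple of [fN] while its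
    moments of order [n > 0] tend to 0 by [rogers_moment_cvg0]. *)
Lemma fN_functional : exists L : {scalar {poly R}},
  (forall p, L p = \int[mu]_(x in S) (p.[x] * fN q x)) /\
  (forall n, (0 < n)%N -> L (H n) = 0).
Proof.
have [L hL] := weight_functional bounded_mfun_fN.
exists L; split => //.
pose c0 := qpoch_oo q q * Num.sqrt (1 - q) / (2 * pi).
have lim p : \int[mu]_(x in S) (p.[x] * (c0 * fN_trunc q N.+1 x)) @[N --> \oo] --> L p.
  rewrite hL.
  have [mp [Mp hMp]] := bounded_mfun_horner q p.
  have [B B0 hB] := fN_trunc_bound hq.
  apply: (@bounded_convergence _ (measurableTypeR R) R mu S (measurable_supp q)
    (supp_lty q) (fun N x => p.[x] * (c0 * fN_trunc q N.+1 x)) _ (Mp * (`|c0| * B))).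
  - move=> N; apply: measurable_funM; first exact: mp.
    apply: measurable_funM; first exact: measurable_cst.
    exact: (bounded_mfun_fN_trunc hq N.+1).1.
  - move=> N x hx; rewrite normrM [X in _ * X]normrM ler_pM ?hMp// ler_wpM2l//.
    by case/andP: (hB x N.+1 hx) => w0 wB; rewrite ger0_norm.
  - move=> x hx; apply: cvgMr.
    by rewrite (cvg_shiftS (fun N => c0 * fN_trunc q N x)); exact: fN_trunc_cvg.
have fold N p : \int[mu]_(x in S) (p.[x] * (c0 * fN_trunc q N.+1 x)) =
    c0 * \int[mu]_(x in S) (p.[x] * fN_trunc q N.+1 x).
  rewrite -Rintegral_boundedZ; first by apply: eq_Rintegral => x _; rewrite mulrCA.
  - exact: measurable_supp.
  - exact: supp_lty.
  - by apply: bounded_mfunM; [exact: bounded_mfun_horner|exact: bounded_mfun_fN_trunc].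
move=> n n0; have := lim (H n).
have : n = (2 * n./2 + odd n)%N by lia.
case: (odd n) => nE; rewrite nE.
  rewrite (_ : (fun N => _) = cst 0); last first.
    apply/funext => N; rewrite fold.
    have [LN hLN] := weight_functional (bounded_mfun_fN_trunc hq N.+1).
    by have [_ ho] := fN_trunc_rogers_moments hLN; rewrite -hLN addn1 ho mulr0.
  by move=> h; apply/esym/(cvg_unique _ _ h) => //; exact: cvg_cst.
rewrite addn0 in nE *.
rewrite (_ : (fun N => _) = fun N => rogers_moment q (q ^+ N.+1) n./2 *
   \int[mu]_(x in S) ((1 : {poly R}).[x] * (c0 * fN_trunc q N.+1 x))); last first.
  apply/funext => N; rewrite !fold.
  have [LN hLN] := weight_functional (bounded_mfun_fN_trunc hq N.+1).
  by have [he _] := fN_trunc_rogers_moments hLN; rewrite -!hLN he; ring.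
move=> h.
have h' := cvgM (rogers_moment_cvg0 (_ : (0 < n./2)%N)) (lim 1).
rewrite -(cvg_lim _ h)//; apply/cvg_lim => //.
by rewrite -(mul0r (L 1)); apply: h'; lia.
Qed.

End Orthogonality.

(** * The mixed sum and triple products *)

Section Mixed.
Context {R : realType} (q : R).
Hypothesis hq : -1 < q < 1.
Implicit Types (a b : R) (m n s k N : nat).

Lemma qbinomE i j : qbinom q (i + j) i = qfact q (i + j) / (qfact q i * qfact q j).
Proof. by rewrite /qbinom leq_addr addKn. Qed.

Definition mixed_triples a b m n s : R :=
  \sum_(0 <= k < s.+1) a ^+ k * b ^+ (s - k) /
    (qfact q k * qfact q (s - k)) * (triple q m k (s - k) * triple q n k (s - k)).

Definition mixed_cond m n s :=
  [&& (maxn m n <= s)%N, ~~ odd (s - m) & ~~ odd (s - n)].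

Lemma mixed_triples0 a b m n s : ~~ mixed_cond m n s -> mixed_triples a b m n s = 0.
Proof.
move=> hc; rewrite /mixed_triples big_nat big1// => k /andP[_ ks].
suff [->|->] : triple q m k (s - k) = 0 \/ triple q n k (s - k) = 0.
- by rewrite mul0r mulr0.
- by rewrite !mulr0.
have [tm|tm] := boolP (triangle m k (s - k)); last by left; rewrite triple0.
right; rewrite triple0//; apply: contra hc => tn.
move: tm tn; rewrite /triangle /mixed_cond => /and4P[? ? ? ?] /and4P[? ? ? ?].
by apply/and3P; split; lia.
Qed.

(** In a triangle [(l, k, s - k)] the third parameter is half of [s - l], so that
    the triple product is a q-binomial coefficient up to q-factorials. *)
Lemma triple_qbinom l s k : (l <= s)%N -> ~~ odd (s - l) ->
  ((s - l)./2 <= k)%N -> (k <= (s + l)./2)%N ->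
  triple q l k (s - k) =
    qbinom q l (k - (s - l)./2) * qfact q k * qfact q (s - k) / qfact q (s - l)./2.
Proof.
move=> ls ol lk kl.
have [i [j [c [E1 E2 E3 E4]]]] : exists i j c,
    [/\ l = (i + j)%N, k = (i + c)%N, (s - k = j + c)%N & (s - l)./2 = c].
  by exists (k - (s - l)./2)%N, (l - (k - (s - l)./2))%N, (s - l)./2; split; lia.
rewrite E4 E3 E1 E2 addnK tripleE qbinomE.
by field; rewrite !(qfact_neq0 hq).
Qed.

(** Both triple products are nonzero exactly for [k] in the range of
    [mixed_term]. *)
Lemma mixed_triplesE a b m n s : mixed_cond m n s ->
  mixed_triples a b m n s = mixed_term q a b m n s.
Proof.
move=> /and3P[ms om on]; rewrite /mixed_triples /mixed_term.
rewrite [in RHS](big_nat_widenl _ 0)// [in RHS](big_nat_widen _ _ s.+1); last by lia.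
rewrite mulr_sumr [RHS]big_mkcond /=; apply: eq_big_nat => k /andP[_ ks].
case: ifPn => hk; last first.
  suff [->|->] : triple q m k (s - k) = 0 \/ triple q n k (s - k) = 0.
  - by rewrite mul0r mulr0.
  - by rewrite !mulr0.
  have [tm|tm] := boolP (triangle m k (s - k)); last by left; rewrite triple0.
  right; rewrite triple0//; apply: contra hk => tn.
  move: tm tn; rewrite /triangle => /and4P[? ? ? ?] /and4P[? ? ? ?].
  by apply/andP; split; lia.
have [km mk kn nk /andP[m_s n_s]] : [/\ (k <= (s + m)./2)%N, ((s - m)./2 <= k)%N,
    (k <= (s + n)./2)%N, ((s - n)./2 <= k)%N & (m <= s)%N && (n <= s)%N].
  by split; lia.
rewrite (triple_qbinom m_s om mk km) (triple_qbinom n_s on nk kn).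
have f0 := qfact_neq0 hq.
move: (f0 k) (f0 (s - k)%N) (f0 (s - m)./2) (f0 (s - n)./2).
(* The identity is one in a field, with the q-factorials as indeterminates. *)
move: (qfact q k) (qfact q (s - k)) (qfact q (s - m)./2) (qfact q (s - n)./2).
move: (qbinom q m _) (qbinom q n _) (a ^+ k) (b ^+ (s - k)).
move=> u v ak bk f1 f2 f3 f4 h1 h2 h3 h4.
by field; rewrite h1 h2 h3 h4.
Qed.

Lemma mixed_sumE a b m n N :
  mixed_sum q a b m n N = \sum_(0 <= s < N) mixed_triples a b m n s.
Proof.
rewrite /mixed_sum (big_nat_widenl _ 0)// big_mkcond /=.
apply: eq_big_nat => s _.
have [h|h] := boolP (mixed_cond m n s).
  rewrite (mixed_triplesE a b h); move: h => /and3P[-> -> ->].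
  by [].
rewrite (mixed_triples0 a b h); case: ifP => //.
move=> /andP[/andP[e1 e2] e3]; case/negP: h.
by rewrite /mixed_cond e1 e2 e3.
Qed.

(** Only even [s] contribute, the term of index [2 * j] being [(a * b) ^+ j]. *)
Lemma mixed_sum00 a b M :
  mixed_sum q a b 0 0 (2 * M) = series (fun j => (a * b) ^+ j) M.
Proof.
rewrite mixed_sumE /series /=; elim: M => [|M IH]; first by rewrite !big_geq.
have -> : (2 * M.+1 = (2 * M).+2)%N by lia.
rewrite !big_nat_recr//= IH -addrA; congr (_ + _).
rewrite [X in _ + X]mixed_triples0; last by rewrite /mixed_cond; lia.
rewrite addr0 mixed_triplesE; last by rewrite /mixed_cond; lia.
rewrite /mixed_term minnn !subn0 addn0.
have -> : ((2 * M)./2 = M)%N by lia.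
rewrite big_nat1 subnn /qbinom /= subnn !qfact0.
have -> : (2 * M - M = M)%N by lia.
by rewrite exprMn; field; rewrite !(qfact_neq0 hq).
Qed.

(** Only odd [s] contribute; in the term of index [2 * j + 1] the two values of
    [k] give [a] and [b] with equal coefficients. *)
Lemma mixed_sum11 a b M : mixed_sum q a b 1 1 (2 * M) =
  (a + b) * series (fun j => (a * b) ^+ j *
    (qfact q (1 + j) / (qfact q 1 * qfact q j))) M.
Proof.
rewrite mixed_sumE /series /=; elim: M => [|M IH].
  by rewrite !big_geq// mulr0.
have -> : (2 * M.+1 = (2 * M).+2)%N by lia.
rewrite !big_nat_recr//= IH mulrDr -addrA; congr (_ + _).
rewrite mixed_triples0; last by rewrite /mixed_cond; lia.
rewrite add0r mixed_triplesE; last by rewrite /mixed_cond; lia.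
rewrite /mixed_term minnn subSS subn0.
have -> : ((2 * M)./2 = M)%N by lia.
have -> : (((2 * M).+1 + 1)./2 = M.+1)%N by lia.
rewrite big_ltn// big_nat1 subnn -[in (M.+1 - M)%N]addn1 addKn.
have -> : ((2 * M).+1 - M = M.+1)%N by lia.
have -> : ((2 * M).+1 - M.+1 = M)%N by lia.
rewrite /qbinom /= subnn !qfact0 subn0 !qfactS !qfact0 qnat1.
rewrite exprMn !exprS.
by field; rewrite !(qfact_neq0 hq).
Qed.

End Mixed.

(** * Moments under fR *)

Section One_variable.
Context {R : realType} (q : R).
Hypothesis hq : -1 < q < 1.
Context (d : measure_display) (T : measurableType d) (P : probability T R).
Implicit Types (p : {poly R}).
Local Notation H := (qhermite q).
Local Notation mu := (@lebesgue_measure R).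
Local Notation S := (supp q).
Local Notation bmS := (@bounded_mfun _ (measurableTypeR R) R (supp q)).

Variables (r : R) (r1 : `|r| < 1).

Definition fR_part N x : R :=
  (1 - r) * fN q x * series (fun k => mehler_coef q x x k * r ^+ k) N.

Lemma fR_part_cvg x : S x -> fR_part N x @[N --> \oo] --> fR q r x.
Proof.
move=> hx; rewrite fRE//; apply: cvgMr.
have [C [w [C0 w01 h]]] := mehler_coef_geometric hq r1.
exact: geometric_dominated_cvg w01 (fun k => h x x k hx hx).
Qed.

Lemma bounded_mfun_mehler_coef k : bmS (fun x => mehler_coef q x x k).
Proof.
apply: bounded_mfunM; last exact: bounded_mfun_cst.
by apply: bounded_mfunM; exact: bounded_mfun_horner.
Qed.

Lemma bounded_mfun_fR_part N : bmS (fR_part N).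
Proof.
apply: bounded_mfunM.
  by apply: bounded_mfunM; [exact: bounded_mfun_cst|exact: bounded_mfun_fN].
apply: bounded_mfun_sum => k; apply: bounded_mfunM; last exact: bounded_mfun_cst.
exact: bounded_mfun_mehler_coef.
Qed.

Lemma fR_part_bound : exists M, forall N x, S x -> `|fR_part N x| <= M.
Proof.
have [C [w [C0 w01 h]]] := mehler_coef_geometric hq r1.
have [B B0 hB] := fN_bound hq.
exists (`|1 - r| * B * (C / (1 - w))) => N x hx.
rewrite normrM ler_pM//.
  rewrite normrM ler_wpM2l//.
  by case/andP: (hB x hx) => f0 fB; rewrite ger0_norm.
have hv k := h x x k hx hx.
by have := geometric_partial_le w01 hv hv 0 N; rewrite expr0 mulr1.
Qed.

Lemma bounded_mfun_fR : bmS (fR q r).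
Proof.
have [M hM] := fR_part_bound.
apply: (bounded_mfun_limit (F := fR_part)) hM fR_part_cvg => N.
by have [] := bounded_mfun_fR_part N.
Qed.

Lemma fR_ge0 x : S x -> 0 <= fR q r x.
Proof.
move=> hx; rewrite fRE// mulr_ge0 ?mehler_ge0// mulr_ge0//.
  by rewrite subr_ge0 ltW// (le_lt_trans (ler_norm _)).
by have [B B0 hB] := fN_bound hq; case/andP: (hB x hx).
Qed.

Variables (Z : {RV P >-> R}).
Hypothesis dZ : has_density P mu S (fR q r) Z.

Lemma expectation_fR p :
  'E_P[(fun w => p.[Z w])%R]%E = (\int[mu]_(x in S) (p.[x] * fR q r x))%:E.
Proof.
rewrite expectation.unlock.
rewrite (EFin_Rintegral (measurable_supp q) (supp_lty q)); last first.
  by apply: bounded_mfunM; [exact: bounded_mfun_horner|exact: bounded_mfun_fR].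
have mZ : measurable_fun setT (Z : T -> R) by exact: measurable_funP.
apply: (@integral_has_density _ T R P _ (measurableTypeR R) mu S (fR q r) Z
  (measurable_supp q) _ bounded_mfun_fR.1 fR_ge0 dZ (horner p)).
- exact: mZ.
- by apply: continuous_measurable_fun; exact: continuous_horner.
Qed.

(** Termwise integration of the Mehler series of [fR]. The case [j = 0], where the
    expectation is 1, shows that the total mass of [fN] is 1. *)
Lemma expectation_fR_cvg j : exists2 v : R,
  'E_P[(fun w => (H j).[Z w])%R]%E = v%:E &
  (1 - r) * \sum_(0 <= k < N) r ^+ k / qfact q k * triple q j k k
    @[N --> \oo] --> v.
Proof.
have [L [hL L0]] := fN_functional hq.
have lim i : (1 - r) * (\sum_(0 <= k < N) r ^+ k / qfact q k * triple q i k k) * L 1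
    @[N --> \oo] --> \int[mu]_(x in S) ((H i).[x] * fR q r x).
  have [mp [Mp hMp]] := bounded_mfun_horner q (H i).
  have [M hM] := fR_part_bound.
  have E N : \int[mu]_(x in S) ((H i).[x] * fR_part N x) =
      (1 - r) * (\sum_(0 <= k < N) r ^+ k / qfact q k * triple q i k k) * L 1.
    transitivity (\int[mu]_(x in S) (\sum_(0 <= k < N)
        ((1 - r) * (r ^+ k / qfact q k)) * ((H i * H k * H k).[x] * fN q x))).
      apply: eq_Rintegral => x _; rewrite /fR_part /series /= !mulr_sumr.
      apply: eq_bigr => k _; rewrite /mehler_coef !hornerM; ring.
    have bk k : bmS (fun x => (H i * H k * H k).[x] * fN q x).
      by apply: bounded_mfunM; [exact: bounded_mfun_horner|exact: bounded_mfun_fN].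
    rewrite (Rintegral_bounded_sum (measurable_supp q) (supp_lty q)); last first.
      by move=> k; apply: bounded_mfunM => //; exact: bounded_mfun_cst.
    rewrite mulr_sumr mulr_suml; apply: eq_bigr => k _.
    rewrite (Rintegral_boundedZ (measurable_supp q) (supp_lty q))//.
    by rewrite -hL functional_qhermite3//; ring.
  under eq_fun do rewrite -E.
  apply: (@bounded_convergence _ (measurableTypeR R) R mu S (measurable_supp q)
    (supp_lty q) (fun N x => (H i).[x] * fR_part N x) (fun x => (H i).[x] * fR q r x)
    (Mp * M)).
  - by move=> N; apply: measurable_funM => //; have [] := bounded_mfun_fR_part N.
  - by move=> N x hx; rewrite normrM ler_pM ?hMp ?hM.
  - by move=> x hx; apply: cvgMr; exact: fR_part_cvg.
(* [Z] has a law of total mass 1: compare with the case [i = 0] of [lim]. *)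
have c1 : L 1 = 1.
  have E1 : \int[mu]_(x in S) ((H 0).[x] * fR q r x) = 1.
    have := expectation_fR (H 0).
    have -> : (fun w => (H 0).[Z w]) = cst (1 : R).
      by apply/funext => w; rewrite hornerC.
    by rewrite expectation_cst => -[].
  have := lim 0%N; rewrite E1 => h.
  have rr : 1 - r != 0 by rewrite subr_eq0 gt_eqF// (le_lt_trans (ler_norm _)).
  have h' : (1 - r) * (series (geometric 1 r) N) * L 1 @[N --> \oo]
      --> (1 - r) * (1 / (1 - r)) * L 1.
    by apply: cvgMl; apply: cvgMr; rewrite div1r -div1r; exact: cvg_geometric_series.
  have E2 : (fun N => (1 - r) *
      (\sum_(0 <= k < N) r ^+ k / qfact q k * triple q 0 k k) * L 1) =
      fun N => (1 - r) * (series (geometric 1 r) N) * L 1.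
    apply/funext => N; congr (_ * _ * _); apply: eq_bigr => k _.
    rewrite /geometric /= mul1r.
    have := tripleE q 0 0 k; rewrite !add0n => ->.
    by rewrite qfact0; field; rewrite qfact_neq0.
  rewrite E2 in h.
  have E3 : 1 = (1 - r) * (1 / (1 - r)) * L 1.
    exact: cvgn_unique h h'.
  by rewrite [RHS]E3; field.
exists (\int[mu]_(x in S) ((H j).[x] * fR q r x)); first exact: expectation_fR.
by have := lim j; under eq_fun do rewrite c1 mulr1.
Qed.

End One_variable.

Section Part_one.
Context {R : realType} (q : R).
Hypothesis hq : -1 < q < 1.
Context (d : measure_display) (T : measurableType d) (P : probability T R).
Local Notation H := (qhermite q).
Variables (r : R) (r1 : `|r| < 1) (Z : {RV P >-> R}).
Hypothesis dZ : has_density P lebesgue_measure (supp q) (fR q r) Z.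

Lemma triple_sum_even n M :
  \sum_(0 <= k < M + n) r ^+ k / qfact q k * triple q (2 * n) k k =
  r ^+ n * qfact q (2 * n) / qfact q n *
  series (fun j => r ^+ j * (qfact q (n + j) / (qfact q n * qfact q j))) M.
Proof.
rewrite (big_cat_nat (n := n)) ?leq_addl//= big_nat big1 ?add0r; last first.
  move=> k /andP[_ kn]; rewrite triple0 ?mulr0// /triangle.
  by apply/negP => /and4P[]; lia.
rewrite -{1}(add0n n) big_addn addnK /series /= mulr_sumr.
apply: eq_bigr => j _; rewrite [(j + n)%N]addnC mul2n -addnn tripleE exprD.
by field; rewrite !(qfact_neq0 hq).
Qed.

(** The triple products in [expectation_fR_cvg] vanish for [k < n]; shifting [k]
    by [n] leaves a q-binomial series. *)
Lemma expectation_even n : 'E_P[(fun w => (H (2 * n)).[Z w])%R]%E =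
  (r ^+ n * qfact q (2 * n) / (qfact q n * qpoch q (r * q) n))%:E.
Proof.
have [v -> cv] := expectation_fR_cvg hq r1 dZ (2 * n).
congr EFin.
have L1 : (1 - r) * \sum_(0 <= k < N + n) r ^+ k / qfact q k * triple q (2 * n) k k
    @[N --> \oo] --> v.
  by rewrite (cvg_shiftn n (fun N => (1 - r) *
    \sum_(0 <= k < N) r ^+ k / qfact q k * triple q (2 * n) k k)).
have L2 : (1 - r) * \sum_(0 <= k < N + n) r ^+ k / qfact q k * triple q (2 * n) k k
    @[N --> \oo] --> (1 - r) * (r ^+ n * qfact q (2 * n) / qfact q n
      * (qpoch q r n.+1)^-1).
  under eq_fun do rewrite triple_sum_even.
  by apply: cvgMr; apply: cvgMr; exact: qbin_series_cvg.
have -> : v = (1 - r) * (r ^+ n * qfact q (2 * n) / qfact q n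
      * (qpoch q r n.+1)^-1).
  exact: cvgn_unique L1 L2.
have rr : 1 - r != 0 by rewrite subr_eq0 gt_eqF// (le_lt_trans (ler_norm _)).
have p0 : qpoch q (r * q) n != 0.
  by rewrite gt_eqF// qpoch_gt0// normrM mulr_ilt1// normq_lt1.
by rewrite qpoch_recl; field; rewrite qfact_neq0// p0 rr.
Qed.

Lemma expectation_fR0 : 'E_P[Z]%E = 0%E.
Proof.
have [v Ev cv] := expectation_fR_cvg hq r1 dZ 1.
have -> : (Z : T -> R) = fun w => (H 1).[Z w].
  by apply/funext => w; rewrite qhermite1 hornerX.
rewrite Ev; congr EFin.
have : (1 - r) * \sum_(0 <= k < N) r ^+ k / qfact q k * triple q 1 k k
    @[N --> \oo] --> (0 : R).
  rewrite (_ : (fun N => _) = cst 0); first exact: cvg_cst.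
  apply/funext => N; rewrite big1 ?mulr0// => k _; rewrite triple0 ?mulr0//.
  by rewrite /triangle; apply/negP => /and4P[]; lia.
exact: cvgn_unique cv.
Qed.

Lemma expectation_fR_sqr :
  'E_P[(fun w => Z w ^+ 2)%R]%E = ((1 + r) / (1 - r * q))%:E.
Proof.
have [L hL] := weight_functional (bounded_mfun_fR hq r1).
have eL p : 'E_P[(fun w => p.[Z w])%R]%E = (L p)%:E.
  by rewrite (expectation_fR hq r1 dZ) hL.
have -> : (fun w => Z w ^+ 2) = fun w => ('X^2 : {poly R}).[Z w].
  by apply/funext => w; rewrite hornerXn.
(* The second moment is the expectation of H_2 + 1. *)
have X2 : 'X^2 = H (2 * 1) + H (2 * 0).
  by rewrite muln1 muln0 qhermiteSS qhermite1 qnat1 scale1r subrK.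
rewrite eL; congr EFin; rewrite X2 raddfD /=.
have h n : L (H (2 * n)) = r ^+ n * qfact q (2 * n) / (qfact q n * qpoch q (r * q) n).
  by have := eL (H (2 * n)); rewrite expectation_even => -[].
rewrite !h muln0 muln1 !qpochS !qpoch0 !qfactS !qfact0 !expr0 qnat1 (qnat_def hq) mulr1.
have p0 : 1 - r * q != 0.
  rewrite subr_eq0 gt_eqF// (le_lt_trans (ler_norm _))//.
  by rewrite normrM mulr_ilt1// normq_lt1.
by field; rewrite p0 subr1q_neq0.
Qed.

End Part_one.

(** * Moments under fYZ *)

Section Product_integral.
Context {R : realType} {d1 d2 : measure_display}
  {T1 : measurableType d1} {T2 : measurableType d2}.
Variables (m1 : {sigma_finite_measure set T1 -> \bar R})
  (m2 : {sigma_finite_measure set T2 -> \bar R}).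
Variables (D1 : set T1) (D2 : set T2).
Hypotheses (mD1 : measurable D1) (mD2 : measurable D2).
Hypotheses (fD1 : (m1 D1 < +oo)%E) (fD2 : (m2 D2 < +oo)%E).

Lemma measurable_setX_lty :
  measurable (D1 `*` D2) /\ ((m1 \x m2)%E (D1 `*` D2) < +oo)%E.
Proof.
split; first exact: measurableX.
rewrite product_measure1E//.
by rewrite lte_mul_pinfty// ge0_fin_numE.
Qed.

Lemma bounded_mfun_fst (f : T1 -> R) :
  bounded_mfun D1 f -> bounded_mfun (D1 `*` D2) (fun u => f u.1).
Proof.
move=> [mf [M hM]]; split; last by exists M => u [u1 _]; exact: hM.
apply: (measurable_comp mD1) => //; first by move=> _ [u [u1 _] <-].
by apply: measurable_funTS; exact: measurable_fst.
Qed.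

Lemma bounded_mfun_snd (f : T2 -> R) :
  bounded_mfun D2 f -> bounded_mfun (D1 `*` D2) (fun u => f u.2).
Proof.
move=> [mf [M hM]]; split; last by exists M => u [_ u2]; exact: hM.
apply: (measurable_comp mD2) => //; first by move=> _ [u [_ u2] <-].
by apply: measurable_funTS; exact: measurable_snd.
Qed.

Lemma Rintegral_prod (f : T1 -> R) (g : T2 -> R) :
  bounded_mfun D1 f -> bounded_mfun D2 g ->
  \int[(m1 \x m2)%E]_(u in D1 `*` D2) (f u.1 * g u.2) =
  \int[m1]_(x in D1) f x * \int[m2]_(y in D2) g y.
Proof.
move=> bf bg; have [mD fD] := measurable_setX_lty.
have bfg : bounded_mfun (D1 `*` D2) (fun u => f u.1 * g u.2).
  by apply: bounded_mfunM; [exact: bounded_mfun_fst|exact: bounded_mfun_snd].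
have ifg := bounded_mfun_integrable mD fD bfg.
rewrite /Rintegral integral_mkcond -integral12_prod_meas1; last first.
  exact: (integrable_mkcond _ mD).1 ifg.
rewrite -fineM; last 2 first.
- by rewrite -(EFin_Rintegral mD1 fD1 bf).
- by rewrite -(EFin_Rintegral mD2 fD2 bg).
congr fine.
transitivity (\int[m1]_x (((f \_ D1) x)%:E * \int[m2]_(y in D2) (g y)%:E))%E.
  apply: eq_integral => x _.
  rewrite [in RHS]integral_mkcond -integralZl//; last first.
    exact: (integrable_mkcond _ mD2).1 (bounded_mfun_integrable mD2 fD2 bg).
  apply: eq_integral => y _; rewrite !patchE in_setX /=.
  by case: (x \in D1); case: (y \in D2) => /=; rewrite ?mul0e ?mule0 ?EFinM.
rewrite -(EFin_Rintegral mD2 fD2 bg) integralZr//; last first.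
  have := bounded_mfun_integrable mD1 fD1 bf => /(integrable_mkcond _ mD1).
  by rewrite restrict_EFin.
by congr (_ * _)%E; rewrite [RHS]integral_mkcond restrict_EFin.
Qed.

End Product_integral.

Section Two_variables.
Context {R : realType} (q : R).
Hypothesis hq : -1 < q < 1.
Context (d : measure_display) (T : measurableType d) (P : probability T R).
Local Notation H := (qhermite q).
Local Notation mu := (@lebesgue_measure R).
Local Notation S := (supp q).
Local Notation U := (measurableTypeR R).
Local Notation bmS := (@bounded_mfun _ U R (supp q)).
Local Notation bmS2 := (@bounded_mfun _ (U * U)%type R (supp q `*` supp q)).
Local Notation mu2 := (mu \x mu)%E.

Variables (r12 r13 a : R).
Hypotheses (a1 : `|a| < 1) (b1 : `|r12 * r13| < 1).
Let b := r12 * r13.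
Let r := r12 * r13 * a.

Let mS := @measurable_supp R q.
Let fS := @supp_lty R q.

Let r_lt1 : `|r| < 1.
Proof. by rewrite normrM mulr_ilt1. Qed.

Definition fYZ_part N (u : U * U) : R :=
  (1 - r) * fN q u.1 * fN q u.2 *
  triangle_sum (fun k => mehler_coef q u.1 u.2 k * a ^+ k)
    (fun k => mehler_coef q u.1 u.2 k * b ^+ k) N.

Let common_bound : exists C w, [/\ 0 <= C, 0 <= w < 1 &
  forall x y k, S x -> S y -> `|mehler_coef q x y k * a ^+ k| <= C * w ^+ k /\
    `|mehler_coef q x y k * b ^+ k| <= C * w ^+ k].
Proof.
have [C [w [C0 /andP[w0 w1] h]]] := mehler_coef_geometric hq a1.
have [C' [w' [C'0 /andP[w'0 w'1] h']]] := mehler_coef_geometric hq b1.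
exists (Num.max C C'), (Num.max w w'); split.
- by rewrite le_max C0.
- by rewrite le_max w0 gt_max w1 w'1.
- move=> x y k hx hy; split.
    rewrite (le_trans (h x y k hx hy))// ler_pM ?exprn_ge0 ?le_max ?lexx//.
    by rewrite lerXn2r ?nnegrE ?le_max ?lexx ?w0.
  rewrite (le_trans (h' x y k hx hy))// ler_pM ?exprn_ge0 ?le_max ?lexx ?orbT//.
  by rewrite lerXn2r ?nnegrE ?le_max ?lexx ?w0 ?orbT.
Qed.

Lemma fYZ_part_cvg u : (S `*` S) u ->
  fYZ_part N u @[N --> \oo] --> fYZ q r12 r13 a u.1 u.2.
Proof.
move=> [hx hy]; rewrite fYZE//; apply: cvgMr.
have [C [w [C0 w01 h]]] := common_bound.
exact: (triangle_sum_cvg w01 (fun k => (h _ _ k hx hy).1) (fun k => (h _ _ k hx hy).2)).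
Qed.

Let bm1 f : bmS f -> bmS2 (fun u => f u.1).
Proof. exact: bounded_mfun_fst. Qed.

Let bm2 f : bmS f -> bmS2 (fun u => f u.2).
Proof. exact: bounded_mfun_snd. Qed.

Lemma bounded_mfun_fYZ_part N : bmS2 (fYZ_part N).
Proof.
have bm k : bmS2 (fun u => mehler_coef q u.1 u.2 k).
  apply: bounded_mfunM; last exact: bounded_mfun_cst.
  by apply: bounded_mfunM; [apply: bm1|apply: bm2]; exact: bounded_mfun_horner.
apply: bounded_mfunM.
  apply: bounded_mfunM; last by apply: bm2; exact: bounded_mfun_fN.
  by apply: bounded_mfunM; [exact: bounded_mfun_cst|apply: bm1; exact: bounded_mfun_fN].
apply: bounded_mfun_sum => s; apply: bounded_mfun_sum => k.
by apply: bounded_mfunM; apply: bounded_mfunM => //; exact: bounded_mfun_cst.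
Qed.

Lemma fYZ_part_bound : exists M, forall N u, (S `*` S) u -> `|fYZ_part N u| <= M.
Proof.
have [C [w [C0 w01 h]]] := common_bound.
have [B B0 hB] := fN_bound hq.
exists (`|1 - r| * B * B * (C / (1 - w)) ^+ 2) => N u [hx hy].
have fB x : S x -> `|fN q x| <= B.
  by move=> sx; case/andP: (hB x sx) => f0 fB; rewrite ger0_norm.
rewrite normrM ler_pM//; last first.
  exact: (triangle_sum_bound w01 (fun k => (h _ _ k hx hy).1)
    (fun k => (h _ _ k hx hy).2)).
rewrite normrM ler_pM ?fB// normrM ler_pM ?fB//.
Qed.

Lemma bounded_mfun_fYZ : bmS2 (fun u => fYZ q r12 r13 a u.1 u.2).
Proof.
have [M hM] := fYZ_part_bound.
apply: (bounded_mfun_limit (F := fYZ_part)) hM fYZ_part_cvg => N.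
exact: (bounded_mfun_fYZ_part N).1.
Qed.

Lemma fYZ_ge0 u : (S `*` S) u -> 0 <= fYZ q r12 r13 a u.1 u.2.
Proof.
move=> [hx hy]; rewrite fYZE//.
have [B B0 hB] := fN_bound hq.
apply: mulr_ge0; last by apply: mulr_ge0; exact: mehler_ge0.
apply: mulr_ge0; last by case/andP: (hB _ hy).
apply: mulr_ge0; last by case/andP: (hB _ hx).
by rewrite subr_ge0 ltW// (le_lt_trans (ler_norm _)).
Qed.

Variables (Y Z : {RV P >-> R}).
Hypothesis dYZ : has_density P mu2 (S `*` S)
  (fun u : R * R => fYZ q r12 r13 a u.1 u.2) (fun w : T => (Y w, Z w)).

Let mD : measurable (S `*` S : set (U * U)).
Proof. exact: measurableX. Qed.

Let fD : (mu2 (S `*` S) < +oo)%E.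
Proof. exact: (measurable_setX_lty mS mS fS fS).2. Qed.

Lemma expectation_fYZ (p p' : {poly R}) :
  'E_P[(fun w => p.[Y w] * p'.[Z w])%R]%E =
  (\int[mu2]_(u in S `*` S) (p.[u.1] * p'.[u.2] * fYZ q r12 r13 a u.1 u.2))%:E.
Proof.
rewrite expectation.unlock (EFin_Rintegral mD fD); last first.
  apply: bounded_mfunM; last exact: bounded_mfun_fYZ.
  by apply: bounded_mfunM; [apply: bm1|apply: bm2]; exact: bounded_mfun_horner.
have mY : measurable_fun setT (Y : T -> R) by exact: measurable_funP.
have mZ : measurable_fun setT (Z : T -> R) by exact: measurable_funP.
apply: (@integral_has_density _ T R P _ (U * U)%type mu2 (S `*` S)
  (fun u => fYZ q r12 r13 a u.1 u.2) (fun w => (Y w, Z w))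
  mD _ bounded_mfun_fYZ.1 fYZ_ge0 dYZ (fun u => p.[u.1] * p'.[u.2])).
- exact: measurable_fun_pair.
- apply: measurable_funM.
    apply: (measurableT_comp (f := horner p)); last exact: measurable_fst.
    exact: continuous_measurable_fun (@continuous_horner R p).
  apply: (measurableT_comp (f := horner p')); last exact: measurable_snd.
  exact: continuous_measurable_fun (@continuous_horner R p').
Qed.

(** Termwise integration of the Cauchy product of the two Mehler series in [fYZ];
    by Fubini each term is a product of two integrals of triple products. The
    case [m = n = 0] shows that the square of the total mass of [fN] is 1. *)
Lemma expectation_fYZ_cvg m n : exists2 v : R,
  'E_P[(fun w => (H m).[Y w] * (H n).[Z w])%R]%E = v%:E &
  (1 - r) * mixed_sum q a b m n N @[N --> \oo] --> v.
Proof.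
have [L [hL L0]] := fN_functional hq.
pose I i j := \int[mu2]_(u in S `*` S)
  ((H i).[u.1] * (H j).[u.2] * fYZ q r12 r13 a u.1 u.2).
have lim i j : (1 - r) * mixed_sum q a b i j N * (L 1 * L 1) @[N --> \oo] --> I i j.
  have [M hM] := fYZ_part_bound.
  have bH k : bmS (horner (H k)) by exact: bounded_mfun_horner.
  have [mp [Mp hMp]] := bounded_mfunM (bm1 (bH i)) (bm2 (bH j)).
  have E N : \int[mu2]_(u in S `*` S) ((H i).[u.1] * (H j).[u.2] * fYZ_part N u) =
      (1 - r) * mixed_sum q a b i j N * (L 1 * L 1).
    pose G l s k (x : U) := (H l * H k * H (s - k)).[x] * fN q x.
    have bG l s k : bmS (G l s k).
      by apply: bounded_mfunM; [exact: bounded_mfun_horner|exact: bounded_mfun_fN].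
    pose c s k := (1 - r) * (a ^+ k * b ^+ (s - k) / (qfact q k * qfact q (s - k))).
    have bGG s k : bmS2 (fun u => G i s k u.1 * G j s k u.2).
      by apply: bounded_mfunM; [exact: bm1|exact: bm2].
    have bcG s k : bmS2 (fun u => c s k * (G i s k u.1 * G j s k u.2)).
      by apply: bounded_mfunM => //; exact: bounded_mfun_cst.
    transitivity (\int[mu2]_(u in S `*` S) (\sum_(0 <= s < N) \sum_(0 <= k < s.+1)
        c s k * (G i s k u.1 * G j s k u.2))).
      apply: eq_Rintegral => u _; rewrite /fYZ_part /triangle_sum !mulr_sumr.
      apply: eq_bigr => s _; rewrite !mulr_sumr.
      by apply: eq_bigr => k _; rewrite /c /G /mehler_coef !hornerM invfM; ring.
    rewrite (Rintegral_bounded_sum mD fD); last by move=> s; exact: bounded_mfun_sum.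
    rewrite mixed_sumE// mulr_sumr mulr_suml; apply: eq_bigr => s _.
    rewrite (Rintegral_bounded_sum mD fD)// /mixed_triples mulr_sumr mulr_suml.
    apply: eq_bigr => k _.
    rewrite (Rintegral_boundedZ mD fD)// (Rintegral_prod mS mS fS fS)//.
    by rewrite /G -!hL !functional_qhermite3// /c; ring.
  under eq_fun do rewrite -E.
  apply: (@bounded_convergence _ (U * U)%type R mu2 (S `*` S) mD fD
    (fun N u => (H i).[u.1] * (H j).[u.2] * fYZ_part N u) _ (Mp * M)).
  - by move=> N; apply: measurable_funM => //; exact: (bounded_mfun_fYZ_part N).1.
  - by move=> N u hu; rewrite normrM ler_pM ?hMp ?hM.
  - by move=> u hu; apply: cvgMr; exact: fYZ_part_cvg.
(* The law of [(Y, Z)] has total mass 1: compare with the case [i = j = 0]. *)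
have c1 : L 1 * L 1 = 1.
  have E1 : I 0%N 0%N = 1.
    have := expectation_fYZ (H 0) (H 0).
    have -> : (fun w => (H 0).[Y w] * (H 0).[Z w]) = cst (1 : R).
      by apply/funext => w; rewrite !hornerC mulr1.
    by rewrite expectation_cst => -[].
  have := lim 0%N 0%N; rewrite E1 => h.
  have rr : 1 - r != 0 by rewrite subr_eq0 gt_eqF// (le_lt_trans (ler_norm _)).
  have h2 := cvg_double h.
  have h' : (1 - r) * (series (geometric 1 r) N) * (L 1 * L 1) @[N --> \oo]
      --> (1 - r) * (1 / (1 - r)) * (L 1 * L 1).
    by apply: cvgMl; apply: cvgMr; exact: cvg_geometric_series.
  have E3 : 1 = (1 - r) * (1 / (1 - r)) * (L 1 * L 1).
    apply: cvgn_unique h2 _; under eq_fun do rewrite mixed_sum00//.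
    rewrite (_ : series (fun j => (a * b) ^+ j) = series (geometric 1 r))//.
    by congr series; apply/funext => k; rewrite /geometric /= mul1r [a * b]mulrC.
  by rewrite [RHS]E3; field.
exists (I m n); first exact: expectation_fYZ.
by have := lim m n; under eq_fun do rewrite c1 mulr1.
Qed.

End Two_variables.

Section Part_two.
Context {R : realType} (q : R).
Hypothesis hq : -1 < q < 1.
Context (d : measure_display) (T : measurableType d) (P : probability T R).
Local Notation H := (qhermite q).
Variables (r12 r13 a : R).
Hypotheses (a1 : `|a| < 1) (b1 : `|r12 * r13| < 1).
Let b := r12 * r13.
Let r := r12 * r13 * a.
Variables (Y Z : {RV P >-> R}).
Hypothesis dYZ : has_density P (lebesgue_measure \x lebesgue_measure)%E
  (supp q `*` supp q)
  (fun u : R * R => fYZ q r12 r13 a u.1 u.2) (fun w : T => (Y w, Z w)).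

Let r_lt1 : `|r| < 1.
Proof. by rewrite normrM mulr_ilt1. Qed.

Let r_neq1 : 1 - r != 0.
Proof. by rewrite subr_eq0 gt_eqF// (le_lt_trans (ler_norm _)). Qed.

Lemma expectation_mixed m n : cvgn (mixed_sum q a b m n) /\
  'E_P[(fun w => (H m).[Y w] * (H n).[Z w])%R]%E =
  ((1 - r) * limn (mixed_sum q a b m n))%:E.
Proof.
have [v Ev cv] := expectation_fYZ_cvg hq a1 b1 dYZ m n.
have c : mixed_sum q a b m n N @[N --> \oo] --> (1 - r)^-1 * v.
  rewrite (_ : (fun N => _) = fun N => (1 - r)^-1 * ((1 - r) * mixed_sum q a b m n N)).
    exact: cvgMr.
  by apply/funext => N; rewrite mulKf.
split; first exact: cvgP c.
by rewrite Ev (cvg_lim _ c)// mulVKf.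
Qed.

Lemma mixed_sum_odd m n N : odd (m + n) -> mixed_sum q a b m n N = 0.
Proof.
move=> o1; rewrite mixed_sumE// big1// => s _; rewrite mixed_triples0//.
by rewrite /mixed_cond; lia.
Qed.

Lemma expectation_mixed_odd m n : odd (m + n) ->
  'E_P[(fun w => (H m).[Y w] * (H n).[Z w])%R]%E = 0%E.
Proof.
move=> o1; have [_ ->] := expectation_mixed m n.
rewrite (_ : mixed_sum q a b m n = cst 0).
  by rewrite lim_cst// mulr0.
by apply/funext => N; rewrite mixed_sum_odd.
Qed.

Lemma covariance_fYZ : covariance P Y Z = ((a + b) / (1 - r * q))%:E.
Proof.
have EY : 'E_P[Y]%E = 0%E.
  rewrite -(@expectation_mixed_odd 1 0)//; congr (expectation P _).
  by apply/funext => w; rewrite qhermite1 hornerX hornerC mulr1.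
have EZ : 'E_P[Z]%E = 0%E.
  rewrite -(@expectation_mixed_odd 0 1)//; congr (expectation P _).
  by apply/funext => w; rewrite qhermite1 hornerX hornerC mul1r.
rewrite covariance.unlock EY EZ.
have [v Ev cv] := expectation_fYZ_cvg hq a1 b1 dYZ 1 1.
transitivity ('E_P[(fun w => (H 1).[Y w] * (H 1).[Z w])%R]%E).
  congr (expectation P _); apply/funext => w.
  by rewrite qhermite1 !hornerX /= !fctE /= !subr0.
rewrite Ev; congr EFin.
(* [mixed_sum11] evaluates the mixed sum at even indices only, which is enough
   to identify the limit. *)
have h := cvg_double cv.
have h' : (1 - r) * mixed_sum q a b 1 1 (2 * N) @[N --> \oo] -->
    (1 - r) * ((a + b) * (qpoch q (a * b) 2)^-1).
  under eq_fun do rewrite mixed_sum11//.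
  apply: cvgMr; apply: cvgMr; apply: qbin_series_cvg => //.
  by rewrite mulrC.
have -> : v = (1 - r) * ((a + b) * (qpoch q (a * b) 2)^-1).
  exact: cvgn_unique h h'.
have rq : 1 - r * q != 0.
  rewrite subr_eq0 gt_eqF// (le_lt_trans (ler_norm _))//.
  by rewrite normrM mulr_ilt1// normq_lt1.
have r0 := r_neq1; rewrite /r in rq r0 *; rewrite /b.
rewrite !qpochS qpoch0 expr0 expr1 !mulr1 mul1r [a * _]mulrC.
by field; rewrite rq r0.
Qed.

End Part_two.

Theorem lemma2 (R : realType) (q : R) (hq : -1 < q < 1)
    (d : measure_display) (T : measurableType d) (P : probability T R) :
  (forall (r : R) (Z : {RV P >-> R}), `|r| < 1 ->
     has_density P lebesgue_measure (supp q) (fR q r) Z ->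
     [/\ forall n : nat,
           'E_P[(fun w => (qhermite q (2 * n)).[Z w])%R]%E =
           (r ^+ n * qfact q (2 * n) / (qfact q n * qpoch q (r * q) n))%:E,
         'E_P[Z]%E = 0%E,
         'V_P[Z]%E = 'E_P[(fun w => Z w ^+ 2)%R]%E
       & 'E_P[(fun w => Z w ^+ 2)%R]%E = ((1 + r) / (1 - r * q))%:E])
  /\
  (forall (rho12 rho13 rho23 r : R) (Y Z : {RV P >-> R}),
     -1 < rho12 < 1 -> -1 < rho13 < 1 -> -1 < rho23 < 1 ->
     r = rho12 * rho13 * rho23 ->
     has_density P (lebesgue_measure \x lebesgue_measure)%E
       (supp q `*` supp q)
       (fun u : R * R => fYZ q rho12 rho13 rho23 u.1 u.2)
       (fun w : T => (Y w, Z w)) ->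
     (forall m n : nat,
        cvgn (mixed_sum q rho23 (rho12 * rho13) m n) /\
        'E_P[(fun w => (qhermite q m).[Y w] * (qhermite q n).[Z w])%R]%E =
        ((1 - r) * limn (mixed_sum q rho23 (rho12 * rho13) m n))%:E)
     /\
     covariance P Y Z = ((rho23 + rho12 * rho13) / (1 - r * q))%:E).
Proof.
split.
  move=> r Z r1 dZ; have EZ := expectation_fR0 hq r1 dZ; split => //.
  - by move=> n; exact: expectation_even.
  - rewrite /variance covariance.unlock EZ; congr (expectation P _).
    by apply/funext => w; rewrite /= !fctE /= subr0 expr2.
  - exact: expectation_fR_sqr.
move=> r12 r13 r23 r Y Z h12 h13 h23 -> dYZ.
have a1 : `|r23| < 1 by rewrite ltr_norml.
have b1 : `|r12 * r13| < 1 by rewrite normrM mulr_ilt1// ltr_norml.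
split; first by move=> m n; exact: expectation_mixed.
exact: covariance_fYZ.
Qed.
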